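(* There exists a polynomial-time algorithm that solves the reachability problem on unary automatic graphs of finite degree. Precisely: there is an algorithm which, given a (standard one-loop) automaton $\mathcal{A}$ with loop constant $p$ representing a unary automatic graph of finite degree $\mathcal{G}$ (that is, recognizing its edge relation) and two vertices $u,v\in 1^\star$ of $\mathcal{G}$, decides whether $u$ and $v$ are in the same component of $\mathcal{G}$, with running time $O(|u|+|v|+p^{4})$.
   Context: Let $\diamond$ be a symbol different from $1$. The convolution $\otimes(1^m,1^n)$ is the word of length $\max(m,n)$ over $\{1,\diamond\}^2$ whose $k$-th letter is $(a,b)$, where $a=1$ if $k\le m$ and $a=\diamond$ otherwise, and $b=1$ if $k\le n$ and $b=\diamond$ otherwise. An automaton (always a deterministic finite automaton) recognizes a binary relation $E\subseteq 1^\star\times 1^\star$ if it accepts exactly the convolutions of the pairs in $E$. A unary automatic graph is a graph $\mathcal{G}=(V,E)$ with $V=1^\star$ and $E$ recognized by some automaton. Graphs are undirected ($E$ is symmetric). A graph is of finite degree if there are only finitely many edges from each vertex. A component is a connected component. $|u|$ is the length of the word $u$. In an automaton recognizing a binary relation over $1^\star$, the $(1,1)$-states are the states reachable from the initial state by reading letters $(1,1)$; they form a disjoint union of a tail (a sequence of states linked by transitions without repetition) and a loop (a cycle), called the $(1,1)$-tail and $(1,1)$-loop. For a $(1,1)$-state $s$, the states reachable from $s$ by reading letters $(1,\diamond)$ (resp. $(\diamond,1)$) likewise form $(1,\diamond)$-tails and loops (resp. $(\diamond,1)$-tails and loops). A one-loop automaton is one whose transition diagram contains exactly one loop, the $(1,1)$-loop.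 It is standard with loop constant $p$ if its loop and all its tails have length $p$; thus it has $p$ states on the $(1,1)$-tail, $p$ states on the $(1,1)$-loop, and from each of these $2p$ states a $(1,\diamond)$-tail and a $(\diamond,1)$-tail of length $p$. A unary automatic graph of finite degree is always given by a standard one-loop automaton recognizing its edge relation. *)

(* Defs.v *)
From mathcomp Require Import all_boot.
From Stdlib Require Import Relation_Operators.

Set Implicit Arguments.
Unset Strict Implicit.
Unset Printing Implicit Defensive.

(** * Unary words and their convolution *)

(* [tt] plays the role of the letter 1, so [unary] is 1^* and |u| is [size u]. *)
Definition unary := seq unit.

Inductive symbol := One | Diamond.

Definition letter := (symbol * symbol)%type.

Definition pad (u : unary) (k : nat) : symbol :=
  if k < size u then One else Diamond.

Definition convolution (u v : unary) : seq letter :=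
  mkseq (fun k => (pad u k, pad v k)) (maxn (size u) (size v)).

(** * Deterministic finite automata over {1, diamond}^2 *)

(* The transition function is partial: an automaton that is completed by a
   rejecting sink has an extra loop at the sink. *)
Record dfa := Dfa {
  nstates : nat;
  init : 'I_nstates;
  trans : 'I_nstates -> letter -> option 'I_nstates;
  final : {set 'I_nstates} }.

Definition run (A : dfa) (q : 'I_(nstates A)) (w : seq letter) :
    option 'I_(nstates A) :=
  foldl (fun o a => obind (fun q' => trans q' a) o) (Some q) w.

Definition accepts (A : dfa) (w : seq letter) : Prop :=
  exists2 q, run (init A) w = Some q & q \in final A.

Definition recognizes (A : dfa) (E : unary -> unary -> Prop) : Prop :=
  forall w : seq letter,
    accepts A w <-> exists u v, E u v /\ w = convolution u v.

(* The states reached from [q] by reading a^0, a^1, a^2, ... are a tail of [t]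
   states (including [q] itself if 0 < t) followed by a loop of [l] states. *)
Definition tail_loop (A : dfa) (q : 'I_(nstates A)) (a : letter) (t l : nat) :
    Prop :=
  [/\ 0 < l,
      forall i, i < t + l -> run q (nseq i a) <> None,
      forall i j, i < j < t + l -> run q (nseq i a) <> run q (nseq j a)
    & run q (nseq (t + l) a) = run q (nseq t a)].

(* Reading [a] from [s] visits exactly [t] states after [s] and then gets stuck;
   these states are pairwise distinct, since a repetition would never get
   stuck. *)
Definition tail_from (A : dfa) (s : 'I_(nstates A)) (a : letter) (t : nat) :
    Prop :=
  run s (nseq t a) <> None /\ run s (nseq t.+1 a) = None.

Definition state11 (A : dfa) (q : 'I_(nstates A)) : Prop :=
  exists n, run (init A) (nseq n (One, One)) = Some q.

(* There is a (1,1)-loop, and every closed walk of the transition diagram stays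
   in it. *)
Definition one_loop (A : dfa) : Prop :=
  (exists t l, tail_loop (init A) (One, One) t l) /\
  (forall (q : 'I_(nstates A)) (w : seq letter),
     0 < size w -> run q w = Some q ->
     state11 q /\ w = nseq (size w) (One, One)).

Definition standard_one_loop (A : dfa) (p : nat) : Prop :=
  [/\ one_loop A,
      0 < p,
      tail_loop (init A) (One, One) p p
    & forall s : 'I_(nstates A), state11 s ->
        tail_from s (One, Diamond) p /\ tail_from s (Diamond, One) p].

(** * Graphs on 1^* *)

Definition undirected (E : unary -> unary -> Prop) : Prop :=
  forall u v, E u v -> E v u.

Definition finite_degree (E : unary -> unary -> Prop) : Prop :=
  forall u, exists s : seq unary, forall v, E u v -> v \in s.

Definition same_component (E : unary -> unary -> Prop) : unary -> unary -> Prop :=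
  clos_refl_trans unary E.

(** * Random access machines *)

(* Unit-cost RAM with addition and subtraction, but no multiplication: with this
   instruction set, time is polynomially related to Turing machine time.  The
   registers are addressed directly by the program, the memory only indirectly,
   through addresses held in registers. *)
Inductive instr :=
  | IConst of nat & nat          (* r <- n *)
  | IMove of nat & nat           (* r <- s *)
  | IAdd of nat & nat & nat      (* r <- s + t *)
  | ISub of nat & nat & nat      (* r <- s - t, truncated at 0 *)
  | ILoad of nat & nat           (* r <- mem[s] *)
  | IStore of nat & nat          (* mem[r] <- s *)
  | IJump of nat                 (* goto instruction l *)
  | IJumpZ of nat & nat.         (* if r = 0 goto instruction l *)

Definition program := seq instr.

Record config := Config { pc : nat; reg : nat -> nat; mem : nat -> nat }.

Definition upd (f : nat -> nat) (k x : nat) : nat -> nat :=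
  fun i => if i == k then x else f i.

Definition exec (i : instr) (c : config) : config :=
  let: Config k r m := c in
  match i with
  | IConst d n => Config k.+1 (upd r d n) m
  | IMove d s => Config k.+1 (upd r d (r s)) m
  | IAdd d s t => Config k.+1 (upd r d (r s + r t)) m
  | ISub d s t => Config k.+1 (upd r d (r s - r t)) m
  | ILoad d s => Config k.+1 (upd r d (m (r s))) m
  | IStore d s => Config k.+1 r (upd m (r d) (r s))
  | IJump l => Config l r m
  | IJumpZ s l => Config (if r s == 0 then l else k.+1) r m
  end.

(* The machine halts when the program counter leaves the program. *)
Definition halted (P : program) (c : config) : bool := size P <= pc c.

Definition step (P : program) (c : config) : config :=
  if onth P (pc c) is Some i then exec i c else c.

Definition start (x : seq nat) : config :=
  Config 0 (fun _ => 0) (fun a => nth 0 x a).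

(* On input [x], [P] halts after at most [t] steps, with answer [b] in
   register 0. *)
Definition answers_within (P : program) (x : seq nat) (t : nat) (b : bool) :
    Prop :=
  let c := iter t (step P) (start x) in halted P c /\ reg c 0 = b.

(** * Input encoding *)

Definition letters : seq letter :=
  [:: (One, One); (One, Diamond); (Diamond, One); (Diamond, Diamond)].

Definition encode_target (n : nat) (o : option 'I_n) : nat :=
  if o is Some q then q.+1 else 0.

Definition encode_state (A : dfa) (q : 'I_(nstates A)) : seq nat :=
  [seq encode_target (trans q a) | a <- letters] ++ [:: q \in final A : nat].

Definition encode_dfa (A : dfa) : seq nat :=
  [:: nstates A; init A : nat]
    ++ flatten [seq encode_state q | q <- enum 'I_(nstates A)].

(* One memory cell per letter, and a terminating 0. *)
Definition encode_unary (u : unary) : seq nat := nseq (size u) 1 ++ [:: 0].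

Definition encode_input (A : dfa) (u v : unary) : seq nat :=
  encode_dfa A ++ encode_unary u ++ encode_unary v.

(* Main.v *)
Require Import Defs.
From mathcomp Require Import all_boot.
From mathcomp Require Import zify.
From mathcomp.classical Require Import boolp.
From Stdlib Require Import Relation_Operators Operators_Properties.

Set Implicit Arguments.
Unset Strict Implicit.
Unset Printing Implicit Defensive.

(* Edges have length at most p and, from vertex p on, they are invariant under
   translation by p.  This has two consequences.
   - The equivalence that walks to the right of a block of p vertices induce on
     the block can coarsen fewer than p times when the walks are allowed to reach
     one block further, and it stops changing for good once it is stationary.  So
     vertices below c + p that are connected at all are connected below
     c + p + p^2.
   - By the pigeonhole principle a walk that crosses p + 1 blocks visits two
     vertices that are congruent modulo p.  So a vertex x at distance p^2 from the
     start is either joined, by a walk of bounded extent, to x + k p for some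
     0 < k <= p, and then all far translates of x may be moved down by k p without
     leaving their component; or the component of x has bounded extent and can be
     read off from a window around x.
   The program computes the components of two windows of 8 p^2 vertices, starting
   at 0 and at p, in time O(p^4), moves u and v down by repeated subtraction in
   time O(|u| + |v|), and compares labels. *)

(** * Periodic graphs with short edges *)

Section PeriodicGraph.

Variables (p : nat) (e : nat -> nat -> bool).
(** [e m d] stands for an edge between [m] and [m + d]; the comparisons guard the truncated
    subtractions. *)
Definition adj (x y : nat) : bool :=
  (x <= y) && e x (y - x) || (y <= x) && e y (x - y).

Definition wadj (lo hi x y : nat) : Prop :=
  [/\ lo <= x < hi, lo <= y < hi & adj x y].

Definition conn (lo hi : nat) : nat -> nat -> Prop :=
  clos_refl_trans nat (wadj lo hi).

Lemma adjC x y : adj x y = adj y x.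
Proof. by rewrite /adj orbC. Qed.

Lemma conn_refl lo hi x : conn lo hi x x.
Proof. exact: rt_refl. Qed.

Lemma conn_trans lo hi x y z : conn lo hi x y -> conn lo hi y z -> conn lo hi x z.
Proof. exact: rt_trans. Qed.

Lemma conn_sym lo hi x y : conn lo hi x y -> conn lo hi y x.
Proof.
elim=> [a b [ha hb ab]|a|a b c _ IH1 _ IH2]; last exact: conn_trans IH2 IH1.
- by apply: rt_step; split=> //; rewrite adjC.
- exact: conn_refl.
Qed.

Lemma conn_adj lo hi x y :
  lo <= x < hi -> lo <= y < hi -> adj x y -> conn lo hi x y.
Proof. by move=> *; apply: rt_step. Qed.

Lemma conn_ind_r lo hi x (I : nat -> Prop) :
  I x ->
  (forall y z, conn lo hi x y -> I y -> wadj lo hi y z -> I z) ->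
  forall y, conn lo hi x y -> I y.
Proof.
move=> Ix IS y /clos_rt_rtn1_iff xy; elim: xy => // b c bc xb Ib.
by apply: (IS b) => //; apply/clos_rt_rtn1_iff.
Qed.

Lemma conn_widen lo hi lo' hi' x y :
  lo' <= lo -> hi <= hi' -> conn lo hi x y -> conn lo' hi' x y.
Proof.
move=> le1 le2; elim=> [a b [ha hb ab]|a|a b c _ IH1 _ IH2].
- by apply: conn_adj => //; lia.
- exact: conn_refl.
- exact: conn_trans IH1 IH2.
Qed.

Lemma conn_range lo hi x y : conn lo hi x y -> lo <= x < hi -> lo <= y < hi.
Proof. by move=> xy hx; move: y xy; apply: conn_ind_r => // y z _ _ []. Qed.

Hypothesis e_periodic : forall m d, p <= m -> e (m + p) d = e m d.

Lemma e_shift m d k : p <= m -> e (m + k * p) d = e m d.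
Proof.
move=> pm; elim: k => [|k IH]; first by rewrite mul0n addn0.
by rewrite mulSn addnCA addnC e_periodic ?IH //; lia.
Qed.

Lemma adj_shift x y k : p <= x -> p <= y -> adj (x + k * p) (y + k * p) = adj x y.
Proof.
move=> px py; rewrite /adj !leq_add2r !subnDr.
by congr ((_ && _) || (_ && _)); rewrite e_shift.
Qed.

Lemma conn_shift lo hi k x y :
  p <= lo -> conn lo hi x y -> conn (lo + k * p) (hi + k * p) (x + k * p) (y + k * p).
Proof.
move=> plo; elim=> [a b [ha hb ab]|a|a b c _ IH1 _ IH2].
- by apply: conn_adj; rewrite ?adj_shift //; lia.
- exact: conn_refl.
- exact: conn_trans IH1 IH2.
Qed.

(** Each step ends at or above [lo + k * p], hence at a translate of some vertex from [lo] on, and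
    from [p] on adjacency is invariant under translation. *)
Lemma conn_unshift lo hi k x y :
  p <= lo -> conn (lo + k * p) (hi + k * p) (x + k * p) (y + k * p) -> conn lo hi x y.
Proof.
move=> plo.
suff H z : conn (lo + k * p) (hi + k * p) (x + k * p) z ->
    exists2 y', z = y' + k * p & conn lo hi x y'.
  by case/H => y' /addIn ->.
move: z; apply: conn_ind_r; first by exists x => //; exact: conn_refl.
move=> _ z _ [y' -> xy'] [h1 h2 ad]; exists (z - k * p); first by lia.
apply: conn_trans xy' _; apply: conn_adj; try lia.
by rewrite -(@adj_shift _ _ k); [rewrite subnK //; lia|lia|lia].
Qed.

Hypothesis p_gt0 : 0 < p.
Hypothesis e_short : forall m d, e m d -> d <= p.

Lemma adj_short x y : adj x y -> x <= y + p /\ y <= x + p.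
Proof. by case/orP => /andP[xy /e_short]; lia. Qed.

(* A walk crosses the vertices from [c] on in excursions that start and end in
   [c, c + p), because no edge is longer than [p]. *)
Lemma conn_replace lo c hi hi' x y :
  c + p <= hi' ->
  (forall z w, c <= z < c + p -> c <= w < c + p -> conn c hi z w -> conn c hi' z w) ->
  lo <= c -> lo <= x < c + p -> lo <= y < c + p ->
  conn lo hi x y -> conn lo hi' x y.
Proof.
move=> hhi' Hrep loc hx hy xy.
suff {hy}: (y < c /\ conn lo hi' x y) \/
    (c <= y /\ exists2 z, c <= z < c + p & conn lo hi' x z /\ conn c hi z y).
  case=> [[]//|[cy [z hz [xz zy]]]]; apply: conn_trans xz _.
  apply: (@conn_widen c hi') => //; apply: Hrep => //; lia.
move: y xy; apply: conn_ind_r.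
  case: (ltnP x c) => cx; [left|right]; split=> //; first exact: conn_refl.
  by exists x; [lia|split; exact: conn_refl].
move=> y z _ IH [hy hz ad]; have [h1 h2] := adj_short ad.
case: IH => [[yc xy]|[cy [w hw [xw wy]]]].
  have yz : conn lo hi' y z by apply: conn_adj => //; lia.
  have xz := conn_trans xy yz.
  case: (ltnP z c) => cz; [by left|right; split=> //].
  by exists z; [lia|split=> //; exact: conn_refl].
case: (ltnP z c) => cz; [left|right]; split=> //; last first.
  exists w => //; split=> //; apply: conn_trans wy _; apply: conn_adj => //; lia.
have wy' : conn c hi' w y by apply: Hrep => //; lia.
apply: conn_trans xw _; apply: conn_trans (conn_widen loc (leqnn _) wy') _.
by apply: conn_adj => //; lia.
Qed.

(** * Saturation of the walks to the right of a block *)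

Section Saturation.

Variable c : nat.
Hypothesis p_le_c : p <= c.

(** The arguments [x] and [y] are offsets from [c]; [d] counts the blocks beyond [[c, c + p)] that
    the walk may use. *)
Let reach d x y := conn c (c + p + d * p) (c + x) (c + y).

(* Least elements of the classes of [reach d]: fewer of them means coarser classes. *)
Definition min_reps d : {set 'I_p} :=
  [set x : 'I_p | `[< forall y : 'I_p, y < x -> ~ reach d y x >]].

Lemma reach_mono d d' x y : d <= d' -> reach d x y -> reach d' x y.
Proof. by move=> dd'; apply: conn_widen => //; rewrite leq_add2l leq_mul2r dd' orbT. Qed.

Lemma min_reps_mono d : min_reps d.+1 \subset min_reps d.
Proof.
apply/subsetP => x; rewrite !inE => /asboolP h; apply/asboolP => y yx r.
exact: (h y yx (reach_mono (leqnSn d) r)).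
Qed.

Lemma min_reps_ex d (x : 'I_p) : exists2 y : 'I_p, y \in min_reps d & reach d y x.
Proof.
have [n] := ubnP (val x); elim: n x => // n IH x xn.
case: (boolP (x \in min_reps d)) => [|]; first by exists x => //; exact: conn_refl.
rewrite inE => /asboolPn/existsNP[y /not_implyP[yx /contrapT yx']].
case: (IH y) => [|z zm zy]; first by rewrite (leq_trans yx).
by exists z => //; apply: conn_trans zy yx'.
Qed.

Lemma min_reps_inj d (x y : 'I_p) :
  x \in min_reps d -> y \in min_reps d -> reach d x y -> x = y.
Proof.
rewrite !inE => /asboolP hx /asboolP hy xy; apply: val_inj.
case: (ltngtP x y) => // [/hy|/hx] h; first by case: (h xy).
by case: h; apply: conn_sym.
Qed.

(** The least representatives of [x] and [y] at level [d] are still representatives at level [d.+1],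
    where they are joined, so they coincide. *)
Lemma min_reps_eq d (x y : 'I_p) :
  min_reps d.+1 = min_reps d -> reach d.+1 x y -> reach d x y.
Proof.
move=> eqm xy.
have [x0 x0m x0x] := min_reps_ex d x; have [y0 y0m y0y] := min_reps_ex d y.
have x0y0 : x0 = y0.
  apply: (@min_reps_inj d.+1); rewrite ?eqm //.
  apply: conn_trans (reach_mono (leqnSn d) x0x) _.
  by apply: conn_trans xy (conn_sym (reach_mono (leqnSn d) y0y)).
by apply: conn_trans (conn_sym x0x) _; rewrite x0y0.
Qed.

(** Each strict inclusion in the decreasing chain of subsets of ['I_p] costs an element, and [p + 1]
    strict inclusions are too many. *)
Lemma min_reps_stabilizes : exists2 d, d <= p & min_reps d.+1 = min_reps d.
Proof.
apply: contrapT => /forall2NP h.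
suff H n : n <= p.+1 -> #|min_reps n| + n <= p.
  by have := H p.+1 (leqnn _); lia.
elim: n => [|n IH] hn; first by rewrite addn0 -[leqRHS]card_ord max_card.
have [/negP|neq] := h n; first by rewrite -ltnNge; lia.
have : min_reps n.+1 \proper min_reps n.
  by rewrite properEneq min_reps_mono andbT; apply/eqP.
by move/proper_card; move: (IH (ltnW hn)); lia.
Qed.

(** An excursion beyond the first block, moved down by [p], is a walk of level [d.+1]. The
    hypothesis shortens it by one block, and moving it back up gives the replacement that
    [conn_replace] asks for. *)
Lemma reach_stable_step d :
  (forall x y, x < p -> y < p -> reach d.+1 x y -> reach d x y) ->
  forall x y, x < p -> y < p -> reach d.+2 x y -> reach d.+1 x y.
Proof.
move=> H x y xp yp; apply: (@conn_replace c (c + p)); try lia.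
move=> z w hz hw zw.
have zw' : reach d.+1 (z - c - p) (w - c - p).
  apply: (@conn_unshift _ _ 1) => //; rewrite mul1n.
  have -> : c + (z - c - p) + p = z by lia.
  have -> : c + (w - c - p) + p = w by lia.
  by apply: conn_widen zw; lia.
have := @conn_shift c _ 1 _ _ p_le_c (H _ _ _ _ zw').
rewrite mul1n.
have -> : c + (z - c - p) + p = z by lia.
have -> : c + (w - c - p) + p = w by lia.
have -> : c + p + d * p + p = c + p + d.+1 * p by rewrite mulSn; lia.
by apply; lia.
Qed.

Lemma reach_saturates d x y : x < p -> y < p -> reach d x y -> reach p x y.
Proof.
have [d0 d0p stab] := min_reps_stabilizes.
have H j x' y' : x' < p -> y' < p -> reach (d0 + j).+1 x' y' -> reach (d0 + j) x' y'.
  elim: j x' y' => [|j IH] x' y' hx hy.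
    rewrite addn0; exact: (@min_reps_eq d0 (Ordinal hx) (Ordinal hy) stab).
  by rewrite addnS; apply: reach_stable_step.
have H' j : x < p -> y < p -> reach (d0 + j) x y -> reach d0 x y.
  elim: j => [|j IH] hx hy; first by rewrite addn0.
  by rewrite addnS => /(H _ _ _ hx hy); apply: IH.
move=> hx hy /(reach_mono (leq_addl d0 d)) /(H' _ hx hy); exact: reach_mono.
Qed.

End Saturation.

Lemma conn_saturates c hi x y :
  p <= c -> x < c + p -> y < c + p ->
  conn 0 hi x y -> conn 0 (c + p + p * p) x y.
Proof.
move=> pc hx hy; apply: (@conn_replace 0 c hi); try lia.
move=> z w hz hw zw.
have -> : z = c + (z - c) by lia.
have -> : w = c + (w - c) by lia.
(* Any number of blocks that covers [hi] will do; [hi] itself is large enough because [p] is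
   positive. *)
apply: (@reach_saturates c pc hi); try lia.
have -> : c + (z - c) = z by lia.
have -> : c + (w - c) = w by lia.
by apply: conn_widen zw => //; rewrite -[X in X <= _]muln1; nia.
Qed.

(** No edge is longer than [p], so a walk cannot jump over [p] consecutive vertices. *)
Lemma conn_meets_block lo hi x y a :
  conn lo hi x y -> x < a + p -> a <= y -> lo <= x < hi ->
  exists2 z, a <= z < a + p & conn lo hi x z.
Proof.
move=> xy xa ay hx.
have : y < a \/ exists2 z, a <= z < a + p & conn lo hi x z; last by case=> //; lia.
move: y xy {ay}; apply: conn_ind_r.
  case: (ltnP x a) => ax; [by left|right].
  by exists x; [lia|exact: conn_refl].
move=> y z xy [ya|h] [hy hz ad]; last by right.
case: (ltnP z a) => az; [by left|right; exists z].
  by have := adj_short ad; lia.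
exact: conn_trans xy (conn_adj hy hz ad).
Qed.

Lemma conn_meets_block_down lo hi x y a :
  conn lo hi x y -> a <= x -> y < a + p -> lo <= x < hi ->
  exists2 z, a <= z < a + p & conn lo hi x z.
Proof.
move=> xy xa ya hx.
have hy := conn_range xy hx.
case: (ltnP x (a + p)) => h; first by exists x; [lia|exact: conn_refl].
case: (leqP a y) => h'; first by exists y; [lia|].
have [z hz yz] : exists2 z, a <= z < a + p & conn lo hi y z.
  exact: (conn_meets_block (conn_sym xy)).
by exists z => //; apply: conn_trans xy yz.
Qed.

(* Among [p + 1] equally aligned blocks, two of the chosen vertices have the same
   residue, and shifting the walk from [x] to the lower one yields a walk from
   [x + k * p] to the upper one. *)
Lemma conn_pigeonhole lo hi x (b : nat) (f : nat -> nat) :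
  p <= lo ->
  (forall j, j <= p -> b + j * p <= f j < b + j * p + p) ->
  (forall j, j <= p -> conn lo hi x (f j)) ->
  exists2 k, 0 < k <= p & conn lo (hi + p * p) x (x + k * p).
Proof.
move=> plo fb fx.
have off (j : 'I_p.+1) : f j - (b + j * p) < p.
  by have := fb j (ltn_ord j); lia.
pose g (j : 'I_p.+1) : 'I_p := Ordinal (off j).
have /injectivePn[i [j ij gij]] : ~~ injectiveb g.
  by apply/injectiveP => /leq_card; rewrite !card_ord ltnn.
wlog lij : i j ij gij / i < j.
  move=> W; case: (ltngtP i j) => h; [exact: (W i j)|apply: (W j i) => //|].
    by rewrite eq_sym.
  by case/eqP: ij; apply: val_inj.
exists (j - i); first by have := ltn_ord j; lia.
have fij : f j = f i + (j - i) * p.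
  move: (congr1 val gij) => /= E.
  have := fb i (ltn_ord i); have := fb j (ltn_ord j).
  rewrite mulnBl; have : i * p <= j * p by rewrite leq_mul2r ltnW ?orbT.
  by lia.
have jip : (j - i) * p <= p * p by rewrite leq_mul2r; have := ltn_ord j; lia.
apply: (@conn_trans _ _ _ (f j)).
  by apply: conn_widen (fx j (ltn_ord j)) => //; lia.
rewrite fij; move: (conn_shift (j - i) plo (conn_sym (fx i (ltn_ord i)))).
by apply: conn_widen; rewrite ?leq_addr ?leq_add2l.
Qed.

(** A walk from [x] that touched the lowest or the highest block of the window would meet [p + 1]
    aligned blocks, and [conn_pigeonhole] would produce a forbidden [k]. Edges are too short to
    leave the window without touching one of these two blocks. *)
Lemma component_bounded x s hi y :
  p * p + p <= x < p * p + 2 * p ->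
  (forall k, 0 < k <= p -> ~ conn p (3 * (p * p) + 3 * p) x (x + k * p)) ->
  conn 0 hi (x + s * p) y ->
  p + s * p <= y /\ conn p (2 * (p * p) + 3 * p) x (y - s * p).
Proof.
move=> hx nok.
set lo := p; set hi0 := 2 * (p * p) + 3 * p.
have hxW : lo <= x < hi0 by rewrite /lo /hi0; lia.
have noexit z : conn lo hi0 x z -> z < 2 * p \/ hi0 <= z + p -> False.
  move=> xz hz.
  have [b fb] : exists b, forall j, j <= p ->
      exists y, b + j * p <= y < b + j * p + p /\ conn lo hi0 x y.
    (* On the way down the blocks start at [x - p * p], which is at least [p]; on the way up they
       start at [x]. *)
    case: hz => hz; [exists (x - p * p) => // j jp|exists x => // j jp].
      have jpp : j * p <= p * p by rewrite leq_mul2r jp orbT.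
      have [w hw xw] : exists2 w, x - p * p + j * p <= w < x - p * p + j * p + p &
          conn lo hi0 x w.
        by apply: (conn_meets_block_down xz) => //; lia.
      by exists w.
    have jpp : j * p <= p * p by rewrite leq_mul2r jp orbT.
    have [w hw xw] : exists2 w, x + j * p <= w < x + j * p + p & conn lo hi0 x w.
      by apply: (conn_meets_block xz) => //; rewrite /hi0 in hz; lia.
    by exists w.
  have /choice[g gP] : forall j, exists y, j <= p ->
      b + j * p <= y < b + j * p + p /\ conn lo hi0 x y.
    move=> j; case: (leqP j p) => jp; last by exists 0; lia.
    by have [w hw] := fb j jp; exists w.
  have [k hk xk] := @conn_pigeonhole lo hi0 x b g (leqnn _)
    (fun j jp => (gP j jp).1) (fun j jp => (gP j jp).2).
  by apply: (nok k hk); apply: conn_widen xk => //; rewrite /hi0; lia.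
move: y; apply: conn_ind_r; first by rewrite addnK; split; [lia|exact: conn_refl].
move=> y z _ [py xy] [_ _ ad].
have hy := conn_range xy hxW.
have [h1 h2] := adj_short ad.
have H : p + s * p <= z /\ z - s * p < hi0.
  split; rewrite leqNgt; apply/negP => h.
    by apply: (noexit _ xy); left; lia.
  by apply: (noexit _ xy); right; lia.
split; first by case: H.
apply: conn_trans xy _; apply: conn_adj; [lia|rewrite /lo; lia|].
by rewrite -(@adj_shift _ _ s); [rewrite !subnK //; lia|lia|lia].
Qed.

End PeriodicGraph.

(** * A structured language compiled to the machine *)

(* Registers and memory. *)
Definition store := ((nat -> nat) * (nat -> nat))%type.

Definition effect (s : store) (i : instr) : store :=
  let c := exec i (Config 0 s.1 s.2) in (reg c, Defs.mem c).

Definition straight (i : instr) : bool :=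
  match i with IJump _ | IJumpZ _ _ => false | _ => true end.

Inductive cmd :=
  | Block of seq instr
  | Seq of cmd & cmd
  | While of nat & cmd         (* while r <> 0 *)
  | If of nat & cmd & cmd.     (* if r <> 0 *)

(** Jump targets are absolute, so the code depends on the address [l] at which it is placed. *)
Fixpoint compile (l : nat) (c : cmd) : program :=
  match c with
  | Block bl => bl
  | Seq c1 c2 => let P1 := compile l c1 in P1 ++ compile (l + size P1) c2
  | While r c1 =>
      let P1 := compile l.+1 c1 in
      IJumpZ r (l + size P1 + 2) :: P1 ++ [:: IJump l]
  | If r c1 c2 =>
      let P1 := compile l.+1 c1 in
      let l2 := l + size P1 + 2 in
      let P2 := compile l2 c2 in
      IJumpZ r l2 :: P1 ++ IJump (l2 + size P2) :: P2
  end.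

(** The last index is the exact number of machine steps: a loop round pays for the test and the jump
    back, a true branch for the test and the jump over the other branch. *)
Inductive runs : cmd -> store -> store -> nat -> Prop :=
  | runs_block bl s :
      all straight bl -> runs (Block bl) s (foldl effect s bl) (size bl)
  | runs_seq c1 c2 s1 s2 s3 t1 t2 :
      runs c1 s1 s2 t1 -> runs c2 s2 s3 t2 -> runs (Seq c1 c2) s1 s3 (t1 + t2)
  | runs_while_stop r c s : s.1 r = 0 -> runs (While r c) s s 1
  | runs_while_step r c s1 s2 s3 t1 t2 :
      s1.1 r <> 0 -> runs c s1 s2 t1 -> runs (While r c) s2 s3 t2 ->
      runs (While r c) s1 s3 (t1 + 2 + t2)
  | runs_if_true r c1 c2 s s' t :
      s.1 r <> 0 -> runs c1 s s' t -> runs (If r c1 c2) s s' (t + 2)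
  | runs_if_false r c1 c2 s s' t :
      s.1 r = 0 -> runs c2 s s' t -> runs (If r c1 c2) s s' (t + 1).

Definition config_at (l : nat) (s : store) : config := Config l s.1 s.2.

Lemma onth_cat_size T (s1 s2 : seq T) i :
  onth (s1 ++ s2) (size s1 + i) = onth s2 i.
Proof. by elim: s1. Qed.

Lemma step_at P P1 P2 i s :
  P = P1 ++ i :: P2 -> step P (config_at (size P1) s) = exec i (config_at (size P1) s).
Proof. by move=> ->; rewrite /step /= -[size P1]addn0 onth_cat_size. Qed.

Lemma iter_block P P1 bl P2 s :
  all straight bl -> P = P1 ++ bl ++ P2 ->
  iter (size bl) (step P) (config_at (size P1) s) =
  config_at (size P1 + size bl) (foldl effect s bl).
Proof.
elim: bl P1 s => [|i bl IH] P1 s /=; first by rewrite addn0.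
case/andP=> hi his eP; rewrite -iterS iterSr (step_at _ eP).
have -> : exec i (config_at (size P1) s) = config_at (size (rcons P1 i)) (effect s i).
  by rewrite size_rcons; case: i hi {eP}.
by rewrite IH ?size_rcons ?addSnnS // cat_rcons.
Qed.

Lemma iter_chain T (f : T -> T) n m k x y z :
  k = n + m -> iter n f x = y -> iter m f y = z -> iter k f x = z.
Proof. by move=> -> <- <-; rewrite addnC iterD. Qed.

(** The code sits at its own address inside an arbitrary program, so that the induction hypotheses
    apply to subcommands. *)
Lemma compile_correct c s s' t :
  runs c s s' t -> forall P P1 P2, P = P1 ++ compile (size P1) c ++ P2 ->
  iter t (step P) (config_at (size P1) s) =
  config_at (size P1 + size (compile (size P1) c)) s'.
Proof.
elim=> {c s s' t}.
- by move=> bl s hbl P P1 P2; apply: iter_block.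
- move=> c1 c2 s1 s2 s3 t1 t2 _ IH1 _ IH2 P P1 P2 /= eP.
  set C1 := compile _ c1 in eP *; set C2 := compile _ c2 in eP *.
  apply: (iter_chain (erefl _)) (IH1 _ P1 (C2 ++ P2) _) _.
    by rewrite eP -!catA.
  rewrite -/C1 -size_cat (IH2 P (P1 ++ C1) P2) ?size_cat ?addnA //.
  by rewrite eP -!catA.
- move=> r c s h P P1 P2 /= eP; rewrite (step_at _ eP) /= h eqxx size_cat /=.
  by congr Config; lia.
- move=> r c s1 s2 s3 t1 t2 /eqP/negPf h _ IH1 _ IH2 P P1 P2 eP.
  have := eP => /=; set C := compile _ c => eP'.
  have eP1 : P = rcons P1 (IJumpZ r (size P1 + size C + 2)) ++ C ++ IJump (size P1) :: P2.
    by rewrite eP' cat_rcons /= -!catA.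
  have := IH1 P (rcons P1 (IJumpZ r (size P1 + size C + 2))) (IJump (size P1) :: P2).
  rewrite size_rcons => /(_ eP1) IH1'.
  apply: (@iter_chain _ _ 1 (t1 + 1 + t2)); [by lia| |].
    by rewrite /= (step_at _ eP') /= h; reflexivity.
  apply: (@iter_chain _ _ (t1 + 1) t2 _ _ (config_at (size P1) s2)) => //.
    apply: iter_chain (erefl _) IH1' _.
    rewrite -/C -(size_rcons P1 (IJumpZ r (size P1 + size C + 2))) -size_cat /=.
    rewrite (@step_at P (rcons P1 (IJumpZ r (size P1 + size C + 2)) ++ C) P2
      (IJump (size P1))) //.
    by rewrite eP1 -catA.
  exact: (IH2 P P1 P2).
- move=> r c1 c2 s s' t /eqP/negPf h _ IH P P1 P2 /=.
  set C1 := compile _ c1; set C2 := compile _ c2 => eP'.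
  have eP1 : P = rcons P1 (IJumpZ r (size P1 + size C1 + 2)) ++ C1 ++
      IJump (size P1 + size C1 + 2 + size C2) :: C2 ++ P2.
    by rewrite eP' cat_rcons /= -!catA.
  have := IH P (rcons P1 (IJumpZ r (size P1 + size C1 + 2)))
    (IJump (size P1 + size C1 + 2 + size C2) :: C2 ++ P2).
  rewrite size_rcons => /(_ eP1) IH'.
  apply: (@iter_chain _ _ 1 (t + 1)); [by lia| |].
    by rewrite /= (step_at _ eP') /= h; reflexivity.
  apply: iter_chain (erefl _) IH' _.
  rewrite -/C1 -(size_rcons P1 (IJumpZ r (size P1 + size C1 + 2))) -size_cat /=.
  rewrite (@step_at P (rcons P1 (IJumpZ r (size P1 + size C1 + 2)) ++ C1) (C2 ++ P2)
    (IJump (size P1 + size C1 + 2 + size C2))) //=; last by rewrite eP1 -catA.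
  by rewrite size_cat /= /config_at; congr Config; lia.
- move=> r c1 c2 s s' t h _ IH P P1 P2 /=.
  set C1 := compile _ c1; set l2 := _ + 2; set C2 := compile _ c2 => eP'.
  have eP1 : P = (P1 ++ IJumpZ r l2 :: C1 ++ [:: IJump (l2 + size C2)]) ++ C2 ++ P2.
    by rewrite eP' /= -!catA /= -!catA.
  apply: (@iter_chain _ _ 1 t); [by lia| |].
    by rewrite /= (step_at _ eP') /= h; reflexivity.
  have sz : size (P1 ++ IJumpZ r l2 :: C1 ++ [:: IJump (l2 + size C2)]) = l2.
    by rewrite !size_cat /= size_cat /l2 /=; lia.
  move: (IH P (P1 ++ IJumpZ r l2 :: C1 ++ [:: IJump (l2 + size C2)]) P2).
  rewrite sz => -> //; rewrite /= size_cat /= /config_at -/C1 -/l2 -/C2.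
  by congr Config; lia.
Qed.

(** * Frame conditions and timed proof rules *)

Definition target (i : instr) : option nat :=
  match i with
  | IConst d _ | IMove d _ | IAdd d _ _ | ISub d _ _ | ILoad d _ => Some d
  | _ => None
  end.

Fixpoint writes (c : cmd) : seq nat :=
  match c with
  | Block bl => pmap target bl
  | Seq c1 c2 | If _ c1 c2 => writes c1 ++ writes c2
  | While _ c1 => writes c1
  end.

Lemma effect_other s i r : target i != Some r -> (effect s i).1 r = s.1 r.
Proof. by case: i => //= *; rewrite /upd ifN // eq_sym. Qed.

(** Only registers are framed; changes of the memory are left to the postconditions. *)
Definition unchanged (c : cmd) (s s' : store) : Prop :=
  forall r, r \notin writes c -> s'.1 r = s.1 r.

Lemma runs_unchanged c s s' t : runs c s s' t -> unchanged c s s'.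
Proof.
rewrite /unchanged; elim=> {c s s' t} //=.
- move=> bl s _ r; elim: bl s => //= i bl IH s hr.
  have [hi hbl] : target i != Some r /\ r \notin pmap target bl.
    case: (target i) hr => [d|] //=; rewrite inE negb_or => /andP[rd ->]; split=> //.
    by apply: contraNneq rd => -[->].
  by rewrite IH // effect_other.
- move=> c1 c2 s1 s2 s3 t1 t2 _ IH1 _ IH2 r.
  by rewrite mem_cat negb_or => /andP[h1 h2]; rewrite IH2 // IH1.
- by move=> r c s1 s2 s3 t1 t2 _ _ IH1 _ IH2 r' h; rewrite IH2 // IH1.
- by move=> r c1 c2 s s' t _ _ IH r'; rewrite mem_cat negb_or => /andP[h1 h2]; rewrite IH.
- by move=> r c1 c2 s s' t _ _ IH r'; rewrite mem_cat negb_or => /andP[h1 h2]; rewrite IH.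
Qed.

Definition wp (c : cmd) (T : nat) (Q : store -> Prop) (s : store) : Prop :=
  exists s' t, [/\ runs c s s' t, t <= T & Q s'].

Lemma wp_weaken c T T' (Q Q' : store -> Prop) s :
  wp c T Q s -> T <= T' ->
  (forall s', unchanged c s s' -> Q s' -> Q' s') -> wp c T' Q' s.
Proof.
move=> [s' [t [r tT q]]] TT' QQ'; exists s', t; split=> //; first exact: leq_trans TT'.
by apply: QQ' => //; apply: runs_unchanged r.
Qed.

Lemma wp_block bl T (Q : store -> Prop) s :
  all straight bl -> size bl <= T -> Q (foldl effect s bl) -> wp (Block bl) T Q s.
Proof. by move=> h hT q; do 2!eexists; split; [exact: runs_block|exact: hT|]. Qed.

Lemma wp_block_post bl T (P Q : store -> Prop) s :
  all straight bl -> size bl <= T -> P (foldl effect s bl) ->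
  (forall s', unchanged (Block bl) s s' -> P s' -> Q s') -> wp (Block bl) T Q s.
Proof. by move=> h hT p; apply: wp_weaken (leqnn T); apply: wp_block p. Qed.

Lemma wp_seq c1 c2 T T1 T2 (Q : store -> Prop) s :
  wp c1 T1 (wp c2 T2 Q) s -> T1 + T2 <= T -> wp (Seq c1 c2) T Q s.
Proof.
move=> [s1 [t1 [r1 h1 [s2 [t2 [r2 h2 q]]]]]] hT; exists s2, (t1 + t2).
by split=> //; [apply: runs_seq r1 r2|lia].
Qed.

Lemma wp_if r c1 c2 T (Q : store -> Prop) s :
  (s.1 r <> 0 -> wp c1 T Q s) -> (s.1 r = 0 -> wp c2 T Q s) ->
  wp (If r c1 c2) (T + 2) Q s.
Proof.
move=> h1 h2; case: (eqVneq (s.1 r) 0) => [h|/eqP h].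
  case: (h2 h) => s' [t [R hT q]]; exists s', (t + 1); split=> //; last by lia.
  exact: runs_if_false.
case: (h1 h) => s' [t [R hT q]]; exists s', (t + 2); split=> //; last by lia.
exact: runs_if_true.
Qed.

(** [n] is the initial value of a strictly decreasing variant, so there are at most [n] rounds, each
    with two steps of overhead, and one final test. *)
Lemma wp_while r c n B T (I : nat -> store -> Prop) (Q : store -> Prop) s :
  I n s ->
  (forall k s', unchanged c s s' -> I k s' -> s'.1 r <> 0 ->
     wp c B (fun s'' => exists2 k', k' < k & I k' s'') s') ->
  (forall k s', unchanged c s s' -> I k s' -> s'.1 r = 0 -> Q s') ->
  n * (B + 2) + 1 <= T ->
  wp (While r c) T Q s.
Proof.
move=> hI hS hQ hT.
suff H k s0 : k <= n -> unchanged c s s0 -> I k s0 ->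
    wp (While r c) (k * (B + 2) + 1) Q s0.
  by case: (H n s (leqnn _) _ hI) => // s' [t [R ht q]]; exists s', t; split=> //; lia.
have [m] := ubnP k; elim: m k s0 => // m IH k s0 km kn un hk.
case: (eqVneq (s0.1 r) 0) => [h|/eqP h].
  exists s0, 1; split; [exact: runs_while_stop|lia|exact: hQ un hk h].
have [s1 [t1 [R1 h1 [k' k'k hk']]]] := hS k s0 un hk h.
have un1 := runs_unchanged R1.
have [|||//|s2 [t2 [R2 h2 q]]] := IH k' s1; [lia|lia| |].
  by move=> x hx; rewrite un1 // un.
exists s2, (t1 + 2 + t2); split=> //; first exact: runs_while_step R1 R2.
have : (k'.+1) * (B + 2) <= k * (B + 2) by rewrite leq_mul2r k'k orbT.
by rewrite mulSn; lia.
Qed.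

(** A halted configuration is a fixed point of [step], so a run that ends early still shows its
    answer at time [T]. *)
Lemma answers_within_compile c T x (b : bool) :
  wp c T (fun s => s.1 0 = b) (fun _ => 0, fun a => nth 0 x a) ->
  answers_within (compile 0 c) x T b.
Proof.
move=> [s' [t [R hT q]]].
set stop := config_at (size (compile 0 c)) s'.
have H : iter t (step (compile 0 c)) (start x) = stop.
  have := compile_correct R (P := compile 0 c) (P1 := [::]) (P2 := [::]).
  by rewrite cats0 /= => /(_ erefl).
have halts : step (compile 0 c) stop = stop by rewrite /step onth_default.
rewrite /answers_within -(subnK hT) iterD H.
have -> n : iter n (step (compile 0 c)) stop = stop by elim: n => //= n ->.
by rewrite /halted /= leqnn; split=> //; rewrite q.
Qed.

(** * The edge relation of a standard automaton *)

Lemma run_cat (A : dfa) (q : 'I_(nstates A)) w1 w2 :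
  run q (w1 ++ w2) = obind (fun q' => run q' w2) (run q w1).
Proof.
rewrite /run foldl_cat; case: (foldl _ (Some q) w1) => //=.
by elim: w2.
Qed.

Lemma run_rcons (A : dfa) (q : 'I_(nstates A)) w a :
  run q (rcons w a) = obind (fun q' => trans q' a) (run q w).
Proof. by rewrite -cats1 run_cat. Qed.

Lemma nseqSr T n (x : T) : nseq n.+1 x = rcons (nseq n x) x.
Proof. by elim: n => //= n [<-]. Qed.

(** The word read is the convolution of the words of length [m] and [m + d]. *)
Definition walk (A : dfa) (m d : nat) : option 'I_(nstates A) :=
  run (init A) (nseq m (One, One) ++ nseq d (Diamond, One)).

Definition edge (A : dfa) (m d : nat) : bool :=
  if walk A m d is Some q then q \in final A else false.

Lemma walk_next11 (A : dfa) m q :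
  walk A m 0 = Some q -> walk A m.+1 0 = trans q (One, One).
Proof. by rewrite /walk !cats0 nseqSr run_rcons => ->. Qed.

Lemma walk_nextD1 (A : dfa) m d q :
  walk A m d = Some q -> walk A m d.+1 = trans q (Diamond, One).
Proof. by rewrite /walk nseqSr -rcons_cat run_rcons => ->. Qed.

Section StandardAutomaton.

Variables (A : dfa) (p : nat).
Hypothesis Astd : standard_one_loop A p.

Let p_gt0 : 0 < p. Proof. by case: Astd. Qed.

Lemma walk11_periodic m : p <= m -> walk A (m + p) 0 = walk A m 0.
Proof.
case: Astd => _ _ [_ _ _ loop] _ pm.
rewrite /walk !cats0 -(subnK pm) -addnA addnC nseqD run_cat loop -run_cat.
by rewrite -nseqD addnC.
Qed.

Lemma walk11_defined m : walk A m 0 <> None.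
Proof.
case: Astd => _ _ [_ def _ _] _.
have [k] := ubnP m; elim: k m => // k IH m mk.
case: (ltnP m (p + p)) => mp; first by rewrite /walk cats0; apply: def.
have -> : m = m - p + p by lia.
by rewrite walk11_periodic; [apply: IH|]; lia.
Qed.

Lemma walk11 m : exists q, walk A m 0 = Some q.
Proof. by case E: (walk A m 0) (@walk11_defined m) => [q|] // _; exists q. Qed.

Lemma walk_from m q d :
  walk A m 0 = Some q -> walk A m d = run q (nseq d (Diamond, One)).
Proof. by rewrite /walk cats0 run_cat => ->. Qed.

Lemma walk_tail m : walk A m p <> None /\ walk A m p.+1 = None.
Proof.
have [q qE] := walk11 m; rewrite !(walk_from _ qE).
case: Astd => _ _ _ /(_ q) [|_ []//].
by exists m; move: qE; rewrite /walk cats0.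
Qed.

Lemma walk_short m d : walk A m d <> None -> d <= p.
Proof.
have [_ stuck] := walk_tail m; rewrite leqNgt => h; apply/negP => pd; apply: h.
rewrite /walk -(subnKC pd) nseqD catA run_cat.
by rewrite -/(walk A m p.+1) stuck.
Qed.

Lemma walk_defined m d : d <= p -> walk A m d <> None.
Proof.
have [def _] := walk_tail m; move=> dp h; apply: def.
by rewrite /walk -(subnKC dp) nseqD catA run_cat -/(walk A m d) h.
Qed.

Lemma edge_short m d : edge A m d -> d <= p.
Proof.
by rewrite /edge => h; apply: (@walk_short m); case: (walk A m d) h.
Qed.

(** From [p] on, the state after [m] letters [(One, One)] lies on the loop of length [p]. Together
    with [edge_short] this makes [edge A] an instance of the periodic graphs above. *)
Lemma edge_periodic m d : p <= m -> edge A (m + p) d = edge A m d.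
Proof.
move=> pm; have [q qE] := walk11 m.
by rewrite /edge !(walk_from d (q := q)) // walk11_periodic.
Qed.

Lemma unaryE (u : unary) : u = nseq (size u) tt.
Proof. by elim: u => [|[] u {1}->]. Qed.

Lemma convolution_le m n :
  m <= n -> convolution (nseq m tt) (nseq n tt) =
            nseq m (One, One) ++ nseq (n - m) (Diamond, One).
Proof.
move=> mn; apply: (@eq_from_nth _ (One, One)) => [|k].
  by rewrite size_mkseq size_cat !size_nseq; lia.
rewrite size_mkseq !size_nseq => hk; rewrite nth_mkseq ?size_nseq //.
rewrite nth_cat !nth_nseq /pad !size_nseq.
have -> : k < n by lia.
by case: (ltnP k m) => // km; rewrite ifT //; lia.
Qed.

(** An accepted word is only known to be the convolution of some pair in the relation; injectivity
    identifies that pair. *)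
Lemma convolution_inj u v u' v' :
  convolution u v = convolution u' v' -> u = u' /\ v = v'.
Proof.
move=> cE.
have sz : maxn (size u) (size v) = maxn (size u') (size v').
  by move: (congr1 size cE); rewrite !size_mkseq.
have padE k : k < maxn (size u) (size v) -> pad u k = pad u' k /\ pad v k = pad v' k.
  move=> hk; move: (congr1 (fun w => nth (One, One) w k) cE).
  by rewrite !nth_mkseq -?sz // => -[].
have eq_pad (x y : unary) M : size x <= M -> size y <= M ->
    (forall k, k < M -> pad x k = pad y k) -> x = y.
  move=> xM yM h; rewrite (unaryE x) (unaryE y); congr nseq; move: h; rewrite /pad.
  case: (ltngtP (size x) (size y)) => // lt h.
    by have := h (size x) (leq_trans lt yM); rewrite ltnn lt.
  by have := h (size y) (leq_trans lt xM); rewrite ltnn lt.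
split; apply: (@eq_pad _ _ (maxn (size u) (size v))) => [||k /padE[]//];
  rewrite ?leq_maxl ?leq_maxr // sz.
  exact: leq_maxl.
exact: leq_maxr.
Qed.

Variable E : unary -> unary -> Prop.
Hypothesis AE : recognizes A E.
Hypothesis E_sym : undirected E.

Lemma edge_le (u v : unary) :
  size u <= size v -> E u v <-> edge A (size u) (size v - size u).
Proof.
move=> uv.
have -> : edge A (size u) (size v - size u) <-> accepts A (convolution u v).
  rewrite [in convolution u v](unaryE u) [in convolution _ v](unaryE v) convolution_le //.
  rewrite /edge /accepts -/(walk A (size u) (size v - size u)).
  by case: (walk A _ _) => [q|]; split=> //; [exists q|case=> q' [<-]|case].
rewrite (AE (convolution u v)); split; first by exists u, v.
by case=> u' [v' [uv' /convolution_inj[-> ->]]].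
Qed.

Lemma adjE u v : E u v <-> adj (edge A) (size u) (size v).
Proof.
rewrite /adj; case: (ltngtP (size u) (size v)) => h /=.
- by rewrite orbF edge_le // ltnW.
- by rewrite -edge_le ?(ltnW h) //; split; apply: E_sym.
- by rewrite edge_le ?h //; split=> [->//|/orP[]].
Qed.

(** A walk is finite, so it stays below some bound. *)
Lemma same_componentE u v :
  same_component E u v <-> exists hi, conn (edge A) 0 hi (size u) (size v).
Proof.
split.
- elim=> {u v} [u v /adjE ad|u|u v w _ [h1 c1] _ [h2 c2]].
  + by exists (size u + size v).+1; apply: conn_adj => //; lia.
  + by exists 0; apply: conn_refl.
  + exists (maxn h1 h2); apply: (@conn_trans _ _ _ _ (size v)).
      by apply: conn_widen c1 => //; lia.
    by apply: conn_widen c2 => //; lia.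
- case=> hi; rewrite {2}[u]unaryE {2}[v]unaryE.
  elim=> {u v} [x y [_ _ ad]|x|x y z _ c1 _ c2].
  + by apply: rt_step; apply/adjE; rewrite !size_nseq.
  + exact: rt_refl.
  + exact: rt_trans c1 c2.
Qed.

End StandardAutomaton.

(** * The transition table in memory *)

Definition encodes (A : dfa) (mem : nat -> nat) : Prop :=
  forall (q : 'I_(nstates A)) i, i < 5 -> mem (5 * q + 2 + i) = nth 0 (encode_state q) i.

Lemma nth_flatten_const T (x0 : T) k (ss : seq (seq T)) i j :
  all (fun s => size s == k) ss -> i < size ss -> j < k ->
  nth x0 (flatten ss) (k * i + j) = nth x0 (nth [::] ss i) j.
Proof.
elim: ss i => //= s ss IH i /andP[/eqP sk hss] hi jk; rewrite nth_cat sk.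
case: i hi => [|i] hi; first by rewrite muln0 add0n jk.
by rewrite mulnS -addnA ltnNge leq_addr /= addKn IH.
Qed.

Lemma size_encode_states (A : dfa) :
  size (flatten [seq encode_state q | q <- enum 'I_(nstates A)]) = 5 * nstates A.
Proof.
rewrite size_flatten /shape -map_comp (eq_map (g := fun=> 5)) //.
rewrite -[X in _ = 5 * X](size_enum_ord (nstates A)).
by elim: (enum _) => //= a s ->; rewrite mulnS.
Qed.

Lemma size_encode_dfa (A : dfa) : size (encode_dfa A) = 5 * nstates A + 2.
Proof. by rewrite /encode_dfa size_cat size_encode_states addnC. Qed.

Lemma encodes_input A u v : encodes A (nth 0 (encode_input A u v)).
Proof.
move=> q i i5; have qn := ltn_ord q.
rewrite /encode_input nth_cat size_encode_dfa ifT; last by lia.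
rewrite /encode_dfa nth_cat /= ifF; last by lia.
have -> : 5 * q + 2 + i - 2 = 5 * q + i by lia.
rewrite nth_flatten_const //; last by rewrite size_map size_enum_ord.
  by rewrite (nth_map q) ?size_enum_ord // nth_ord_enum.
by apply/allP => s /mapP[x _ ->].
Qed.

Section Lookup.

Variables (A : dfa) (mem : nat -> nat).
Hypothesis memA : encodes A mem.

(** With [c = q.+1] the row of [q] begins at [5 * q + 2 = 5 * c - 3]. The multiple of five is
    written with the additions that the machine performs. *)
Lemma lookup11 m c :
  c = encode_target (walk A m 0) -> c != 0 ->
  mem (c + c + (c + c) + c - 3) = encode_target (walk A m.+1 0).
Proof.
case E: (walk A m 0) => [q|] -> //= _; rewrite (walk_next11 E).
by rewrite -[RHS]/(nth 0 (encode_state q) 0) -memA //; congr mem; lia.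
Qed.

Lemma lookupD1 m d c :
  c = encode_target (walk A m d) -> c != 0 ->
  mem (c + c + (c + c) + c - 1) = encode_target (walk A m d.+1).
Proof.
case E: (walk A m d) => [q|] -> //= _; rewrite (walk_nextD1 E).
by rewrite -[RHS]/(nth 0 (encode_state q) 2) -memA //; congr mem; lia.
Qed.

Lemma lookup_final m d c :
  c = encode_target (walk A m d) -> c != 0 ->
  mem (c + c + (c + c) + c + 1) = edge A m d.
Proof.
rewrite /edge; case E: (walk A m d) => [q|] -> //= _.
by rewrite -[RHS]/(nth 0 (encode_state q) 4) -memA //; congr mem; lia.
Qed.

End Lookup.

(** * Labelling the components of a window *)

Section Forest.

Variables (B K : nat) (R : nat -> nat -> Prop).
Hypothesis R_sym : forall x y, R x y -> R y x.
Hypothesis R_trans : forall x y z, R x y -> R y z -> R x z.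

Definition region (a : nat) : bool := B <= a < B + K.

(** Label arrays are pointer forests; a flat one has depth at most one, and only cells related by
    [R] are joined. *)
Definition flat (D : nat -> nat) : Prop :=
  forall x, region x -> [/\ region (D x), D (D x) = D x & R x (D x)].

(** The shape while the neighbours of one vertex are linked: paths of length two occur, but only to
    the root [r]. *)
Definition nearly_flat (r : nat) (D : nat -> nat) : Prop :=
  [/\ region r, D r = r &
    forall x, region x ->
      [/\ region (D x), D (D x) = D x \/ D (D x) = r & R x (D x)]].

Lemma flat_nearly D a : flat D -> region a -> nearly_flat (D a) D.
Proof.
move=> fD ra; have [h1 h2 h3] := fD a ra; split=> // x rx.
by have [h4 h5 h6] := fD x rx; split=> //; left.
Qed.

(** The redirected cell [D b] is a root or already points to [r], so no path grows beyond length
    two. On two-step representatives the update merges the class of [b] into that of [r]. *)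
Lemma link_nearly_flat r D b :
  nearly_flat r D -> region b -> R r b ->
  nearly_flat r (upd D (D b) r) /\
  (forall x, region x -> upd D (D b) r (upd D (D b) r x) =
     if D (D x) == D (D b) then r else D (D x)).
Proof.
move=> [rr Dr nD] rb Rrb; have [rDb Db RDb] := nD b rb.
have Dbb : D (D b) = D b \/ D (D b) = r by [].
split.
  split=> //; first by rewrite /upd; case: eqP.
  move=> x rx; have [rDx Dx RDx] := nD x rx; rewrite /upd; case: (x =P D b) => [xE|xb].
    split=> //; first by right; case: eqP.
    by apply: R_sym; apply: (R_trans Rrb); rewrite xE.
  by split=> //; case: eqP => h; [right|].
move=> x rx; have [rDx Dx RDx] := nD x rx; rewrite /upd.
case: (x =P D b) => [xE|xb].
  rewrite -xE; have -> : (if r == x then r else D r) = r by case: eqP.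
  case: Dx => h; rewrite h ?eqxx //.
  by case: eqP.
case: (D x =P D b) => [->|h]; first by rewrite eqxx.
by case: eqP => // hh; case: Dx; case: Dbb; congruence.
Qed.

Lemma nearly_flat_sqr r D : nearly_flat r D -> flat (fun x => D (D x)).
Proof.
move=> [rr Dr nD] x rx; have [rDx Dx RDx] := nD x rx; have [rDDx DDx RDDx] := nD _ rDx.
split=> //; last exact: R_trans RDx RDDx.
by case: Dx => [h|h]; rewrite !h ?Dr ?h.
Qed.

Lemma nearly_flat_root r D x : nearly_flat r D -> region x -> D (D (D x)) = D (D x).
Proof.
move=> [rr Dr nD] rx; have [rDx [h|h] _] := nD x rx; by rewrite !h ?Dr.
Qed.

End Forest.

(* Registers are notations for numerals so that register lookups compute. *)
Local Notation rAns := 0.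
Local Notation rOne := 3.
Local Notation rThree := 4.
Local Notation rB := 5.
Local Notation rK := 6.
Local Notation rN := 7.
Local Notation rQ := 8.
Local Notation rT := 9.
Local Notation rX := 10.
Local Notation rC := 11.
Local Notation rA := 12.
Local Notation rM := 13.
Local Notation rR := 14.
Local Notation rY := 15.
Local Notation rW := 16.
Local Notation rF := 17.
Local Notation rL := 18.
Local Notation rU := 20.
Local Notation rV := 21.
Local Notation rP := 22.
Local Notation rSq := 23.
Local Notation rThr := 24.
Local Notation rBH := 25.
Local Notation rBG := 26.
Local Notation rQ0 := 27.
Local Notation rDone := 28.
Local Notation rS := 29.
Local Notation rFound := 30.
Local Notation rD := 31.

Definition init_labels : cmd :=
  Seq (Block [:: IMove rX rB; IMove rC rK])
    (While rC (Block [:: IStore rX rX; IAdd rX rX rOne; ISub rC rC rOne])).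

(* Every cell of a window points to a cell of its class.  Redirecting the
   representatives of all neighbours to the representative of the current vertex
   leaves pointer paths of length at most 2, which [compress] shortens to 1.  The
   state with code c = q + 1 (0 when the automaton is stuck) has its (1,1)- and
   (diamond,1)-transitions and its acceptance bit at the addresses 5c - 3, 5c - 1
   and 5c + 1. *)
Definition link_neighbours : cmd :=
  Seq (Block [:: ILoad rR rA; IMove rT rQ; IMove rY rA])
    (While rT
      (Seq (Block [:: IAdd rW rT rT; IAdd rW rW rW; IAdd rW rW rT;
                      IAdd rF rW rOne; ILoad rF rF; ISub rW rW rOne; ILoad rT rW])
      (Seq (If rF (Block [:: ILoad rL rY; IStore rL rR]) (Block [::]))
           (Block [:: IAdd rY rY rOne])))).

Definition compress : cmd :=
  Seq (Block [:: IMove rX rB; IMove rC rK])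
    (While rC (Block [:: ILoad rL rX; ILoad rL rL; IStore rX rL;
                         IAdd rX rX rOne; ISub rC rC rOne])).

Definition label : cmd :=
  Seq init_labels
  (Seq (Block [:: IMove rA rB; IMove rM rN])
    (While rM
      (Seq link_neighbours
      (Seq compress
        (Block [:: IAdd rW rQ rQ; IAdd rW rW rW; IAdd rW rW rQ; ISub rW rW rThree;
                   ILoad rQ rW; IAdd rA rA rOne; ISub rM rM rOne]))))).

(** * Correctness and cost of the labelling *)

Lemma wp_init_labels s B K :
  s.1 rB = B -> s.1 rK = K -> s.1 rOne = 1 ->
  wp init_labels (5 * K + 3) (fun s' => forall a,
    s'.2 a = if region B K a then a else s.2 a) s.
Proof.
move=> hB hK h1.
apply: (@wp_seq _ _ _ 2 (5 * K + 1)); last by lia.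
apply: wp_block => //=; rewrite /upd /=.
apply: (@wp_while _ _ K 3 _ (fun k s' => [/\ s'.1 rC = k, k <= K, s'.1 rX = B + (K - k) &
    forall a, s'.2 a = if B <= a < B + (K - k) then a else s.2 a])) => /=.
- split=> //=; rewrite ?subnn ?addn0 // => a; rewrite ifF //; lia.
- move=> k s' un [hC kK hX hm] nz; have o : s'.1 rOne = 1 by rewrite un.
  apply: wp_block => //=; rewrite /upd /= o.
  exists k.-1; first lia; split; try lia.
  move=> a; rewrite hm; case: eqP => [->|ne]; first by rewrite ifT; lia.
  case: ifP => h; case: ifP => h' //; lia.
- move=> k s' un [hC kK hX hm] z a; rewrite hm /region; congr (if _ then _ else _); lia.
- by lia.
Qed.

Lemma wp_compress s B K R r :
  nearly_flat B K R r s.2 ->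
  s.1 rB = B -> s.1 rK = K -> s.1 rOne = 1 ->
  wp compress (7 * K + 3) (fun s' => forall a,
    s'.2 a = if region B K a then s.2 (s.2 a) else s.2 a) s.
Proof.
move=> nf hB hK h1.
apply: (@wp_seq _ _ _ 2 (7 * K + 1)); last by lia.
apply: wp_block => //=; rewrite /upd /=.
apply: (@wp_while _ _ K 5 _ (fun k s' => [/\ s'.1 rC = k, k <= K, s'.1 rX = B + (K - k) &
    forall a, s'.2 a = if B <= a < B + (K - k) then s.2 (s.2 a) else s.2 a])) => /=.
- split=> //=; rewrite ?subnn ?addn0 // => a; rewrite ifF //; lia.
- move=> k s' un [hC kK hX hm] nz.
  have o : s'.1 rOne = 1 by rewrite un.
  apply: wp_block => //=; rewrite /upd /= o.
  exists k.-1; first lia; split; try lia.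
  have rgX : region B K (s'.1 rX) by rewrite /region; lia.
  (* Compression works in place: the cell pointed to may have been overwritten already, but by
     [nearly_flat_root] it then holds the same representative. *)
  have -> : s'.2 (s'.2 (s'.1 rX)) = s.2 (s.2 (s'.1 rX)).
    rewrite (hm (s'.1 rX)) ifF; last by lia.
    by rewrite hm; case: ifP => // _; apply: nearly_flat_root nf rgX.
  move=> a; case: eqP => [->|ne]; first by rewrite ifT; lia.
  rewrite hm; case: ifP => h; case: ifP => h' //; lia.
- move=> k s' un [hC kK hX hm] z a; rewrite hm /region; congr (if _ then _ else _); lia.
- by lia.
Qed.

Section LinkNeighbours.

Variables (A : dfa) (p : nat).
Hypothesis Astd : standard_one_loop A p.
Variables (B K : nat) (R : nat -> nat -> Prop).
Hypothesis R_sym : forall x y, R x y -> R y x.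
Hypothesis R_trans : forall x y z, R x y -> R y z -> R x z.
Hypothesis B_large : 5 * nstates A + 2 <= B.

(** The last clause records that linking only merges classes, so equalities established for earlier
    vertices survive. *)
Lemma wp_link_neighbours s m b :
  encodes A s.2 -> s.1 rOne = 1 -> s.1 rA = b ->
  s.1 rQ = encode_target (walk A m 0) ->
  B <= b -> b + p < B + K ->
  flat B K R s.2 ->
  (forall d, edge A m d -> R b (b + d)) ->
  wp link_neighbours (14 * p + 18) (fun s' =>
    [/\ forall a, a < B -> s'.2 a = s.2 a,
        nearly_flat B K R (s.2 b) s'.2,
        forall d, edge A m d -> s'.2 (s'.2 (b + d)) = s'.2 (s'.2 b) &
        forall x y, region B K x -> region B K y -> s.2 x = s.2 y ->
          s'.2 (s'.2 x) = s'.2 (s'.2 y)]) s.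
Proof.
move=> enc h1 hA hQ hb hbp fl Rb; set r := s.2 b.
have rgb d : d <= p -> region B K (b + d) by rewrite /region; lia.
have rgb0 : region B K b by have := rgb 0 (leq0n _); rewrite addn0.
apply: (@wp_seq _ _ _ 3 (14 * p + 15)); last by lia.
apply: wp_block => //=.
have nf0 : nearly_flat B K R r s.2 by apply: flat_nearly.
(* The rounds are indexed by the edge length [d], which runs from [0] to [p]; at [d = p.+1] the
   automaton is stuck and [rT] is zero. *)
apply: (@wp_while _ _ p.+1 12 _ (fun k s' => exists d,
   [/\ k + d = p.+1, s'.1 rT = encode_target (walk A m d), s'.1 rY = b + d &
   [/\ forall a, a < B -> s'.2 a = s.2 a,
       nearly_flat B K R r s'.2,
       forall d', d' < d -> edge A m d' -> s'.2 (s'.2 (b + d')) = r,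
       s'.2 (s'.2 b) = r &
       forall x y, region B K x -> region B K y -> s.2 x = s.2 y ->
          s'.2 (s'.2 x) = s'.2 (s'.2 y)]])) => /=.
- exists 0; rewrite /upd /= hA !addn0; split=> //; split=> //; last by move=> x y _ _ ->.
  by case: (fl b rgb0).
- move=> k s' un [d [kd hT hY [hlow nf hd hb' mono]]] /eqP nz.
  have o : s'.1 rOne = 1 by rewrite un.
  have enc' : encodes A s'.2.
    move=> q i i5; rewrite hlow; first exact: enc.
    by have := ltn_ord q; lia.
  have dp : d <= p.
    by apply: (@walk_short _ _ Astd m); move=> h; rewrite hT h in nz.
  apply: (@wp_seq _ _ _ 7 5) => //.
  apply: (wp_block_post (P := fun s1 => [/\ s1.1 rT = encode_target (walk A m d.+1),
      s1.1 rF = edge A m d & s1.2 = s'.2])) => //.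
    by rewrite /= /upd /= o (lookupD1 enc' hT nz) (lookup_final enc' hT nz).
  move=> s1 un1 [T1 F1 M1].
  have O1 : s1.1 rOne = 1 by rewrite un1.
  have Y1 : s1.1 rY = b + d by rewrite un1.
  have R1 : s1.1 rR = r by rewrite un1 // un //= /upd /= hA.
  apply: (@wp_seq _ _ _ 4 1) => //.
  apply: (@wp_if _ _ _ 2); rewrite F1 => fE; apply: wp_block => //; apply: wp_block => //=;
    rewrite /upd /= O1 Y1 ?R1 M1.
    have {fE} fE : edge A m d by case: (edge A m d) fE.
    exists k.-1; first lia; exists d.+1; split=> //; try lia.
    have Rr : R r (b + d).
      by case: (fl b rgb0) => _ _ /R_sym h; apply: R_trans h (Rb d fE).
    have [nf' sq] := link_nearly_flat R_sym R_trans nf (rgb d dp) Rr.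
    rewrite /upd /= in sq.

    split=> //.
    + move=> a aB; rewrite /upd ifF; [exact: hlow|apply/negbTE/eqP] => aE.
      by case: nf => _ _ /(_ _ (rgb d dp)) []; rewrite -aE /region; lia.
    + move=> d'; rewrite ltnS leq_eqVlt => /predU1P[->|d'd] ed';
        rewrite sq ?rgb ?eqxx //; try lia.
      by rewrite hd // if_same.
    + by rewrite sq // hb' if_same.
    + by move=> x y rx ry /(mono x y rx ry) E; rewrite !sq // E.
  have {fE} fE : edge A m d = false by case: (edge A m d) fE.
  exists k.-1; first lia; exists d.+1; split=> //; try lia.
  split=> // d'; rewrite ltnS leq_eqVlt => /predU1P[->|d'd] ed'; last exact: hd.
  by rewrite fE in ed'.
- move=> k s' un [d [kd hT hY [hlow nf hd hb' mono]]] z; split=> // d' ed'.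
  rewrite hb' hd //; rewrite hT in z.
  have dp : p < d.
    by rewrite ltnNge; apply/negP => /(walk_defined Astd (m := m)); case: (walk A m d) z.
  by apply: leq_ltn_trans (edge_short Astd ed') dp.
- by lia.
Qed.

End LinkNeighbours.

(** Edges from the first [N] vertices reach up to [p] further, so [N + p] cells are labelled. Equal
    labels thus prove connectivity in the larger window, while connectivity in the smaller one
    yields equal labels. *)
Definition labels_window (A : dfa) (p m0 B N : nat) (mem : nat -> nat) : Prop :=
  (forall i j, i < N + p -> j < N + p -> mem (B + i) = mem (B + j) ->
     conn (edge A) m0 (m0 + (N + p)) (m0 + i) (m0 + j)) /\
  (forall i j, i < N -> j < N -> conn (edge A) m0 (m0 + N) (m0 + i) (m0 + j) ->
     mem (B + i) = mem (B + j)).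

(** Each of the [N] rounds compresses the whole window of [N + p] cells; with [N = 8 * (p * p)] this
    accounts for the [p ^ 4] in the running time. *)
Lemma wp_label A p s m0 B N :
  standard_one_loop A p ->
  5 * nstates A + 2 <= B ->
  encodes A s.2 -> s.1 rOne = 1 -> s.1 rThree = 3 ->
  s.1 rB = B -> s.1 rN = N -> s.1 rK = N + p ->
  s.1 rQ = encode_target (walk A m0 0) ->
  wp label (5 * (N + p) + N * (14 * p + 7 * (N + p) + 30) + 6) (fun s' =>
    (forall a, a < B -> s'.2 a = s.2 a) /\ labels_window A p m0 B N s'.2) s.
Proof.
move=> Astd Bl enc h1 h3 hB hN hK hQ; set K := N + p.
pose R a b := conn (edge A) m0 (m0 + K) (m0 + (a - B)) (m0 + (b - B)).
have R_refl x : R x x by apply: conn_refl.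
have R_sym x y : R x y -> R y x by apply: conn_sym.
have R_trans x y z : R x y -> R y z -> R x z by apply: conn_trans.
apply: (@wp_seq _ _ _ (5 * K + 3) (N * (14 * p + 7 * K + 30) + 3)); last by lia.
apply: wp_weaken (wp_init_labels hB hK h1) (leqnn _) _ => s1 un1 m1.
apply: (@wp_seq _ _ _ 2 (N * (14 * p + 7 * K + 30) + 1)); last by lia.
apply: wp_block => //.
pose I k (s' : store) := exists i,
   [/\ k + i = N, s'.1 rM = k, s'.1 rA = B + i, s'.1 rQ = encode_target (walk A (m0 + i) 0) &
   [/\ forall a, a < B -> s'.2 a = s.2 a, flat B K R s'.2 &
       forall i' d, i' < i -> edge A (m0 + i') d -> s'.2 (B + i' + d) = s'.2 (B + i')]].
apply: (@wp_while _ _ N (14 * p + 7 * K + 28) _ I).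
- exists 0; rewrite /= /upd /= !un1 // hB hN hQ !addn0; split=> //; split=> //.
    by move=> a aB; rewrite m1 ifF // /region; lia.
  by move=> x rx; have E : s1.2 x = x; [rewrite m1 rx|rewrite !E].
- move=> k s2 un2 [i [ki hM hA hQ2 [hlow fl seen]]] nz.
  have hB2 : s2.1 rB = B by rewrite un2 //= /upd /= un1.
  have hK2 : s2.1 rK = K by rewrite un2 //= /upd /= un1.
  have hO2 : s2.1 rOne = 1 by rewrite un2 //= /upd /= un1.
  have hT2 : s2.1 rThree = 3 by rewrite un2 //= /upd /= un1.
  have enc_low (s' : store) : (forall a, a < B -> s'.2 a = s.2 a) -> encodes A s'.2.
    by move=> low q j j5; rewrite low; [exact: enc|have := ltn_ord q; lia].
  have Rb d : edge A (m0 + i) d -> R (B + i) (B + i + d).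
    move=> ed; have dp := edge_short Astd ed; apply: conn_adj; rewrite /K; try lia.
    by rewrite /adj; apply/orP; left; apply/andP; split; [lia|move: ed; congr edge; lia].
  apply: (@wp_seq _ _ _ (14 * p + 18) (7 * K + 10)); last by lia.
  have bp : B + i + p < B + K by rewrite /K; lia.
  have := wp_link_neighbours Astd R_sym R_trans Bl (enc_low s2 hlow) hO2 hA hQ2
    (leq_addr _ _) bp fl Rb.
  move/wp_weaken; apply=> // s3 un3 [low3 nf3 new3 mono3].
  have hB3 : s3.1 rB = B by rewrite un3.
  have hK3 : s3.1 rK = K by rewrite un3.
  have hO3 : s3.1 rOne = 1 by rewrite un3.
  apply: (@wp_seq _ _ _ (7 * K + 3) 7); last by lia.
  move: (wp_compress nf3 hB3 hK3 hO3) => /wp_weaken; apply=> // s4 un4 m4.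
  have hO4 : s4.1 rOne = 1 by rewrite un4.
  have hT4 : s4.1 rThree = 3 by rewrite un4 // un3.
  have hM4 : s4.1 rM = k by rewrite un4 // un3.
  have hA4 : s4.1 rA = B + i by rewrite un4 // un3.
  have hQ4 : s4.1 rQ = encode_target (walk A (m0 + i) 0) by rewrite un4 // un3.
  have low4 a : a < B -> s4.2 a = s.2 a.
    by move=> aB; rewrite m4 ifF ?low3 ?hlow // /region; lia.
  apply: wp_block => //.
  have nzQ : s4.1 rQ != 0.
    by rewrite hQ4; case: (walk11 Astd (m0 + i)) => q ->.
  rewrite /I /= /upd /= hT4 hO4 (lookup11 (enc_low s4 low4) hQ4 nzQ) hM4 hA4.
  exists k.-1; first by lia.
  have r4 x : region B K x -> s4.2 x = s3.2 (s3.2 x) by move=> rx; rewrite m4 rx.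
  exists i.+1; split; [lia|lia|lia|by rewrite addnS|split=> //].
    have fl4 := nearly_flat_sqr R_trans nf3.
    by move=> x rx; have [f1 f2 f3] := fl4 x rx; rewrite !r4.
  move=> i' d; rewrite ltnS leq_eqVlt => ii ed; have dp := edge_short Astd ed.
  rewrite !r4 ?/region /K; try lia.
  case/predU1P: ii => [iE|ii]; first by rewrite iE in ed *; apply: new3.
  by apply: mono3; rewrite ?/region /K; try lia; apply: seen.
- move=> k s2 un2 [i [ki hM hA hQ2 [hlow fl seen]]] z.
  have {ki z} iN : i = N by lia.
  rewrite {i}iN in hA hQ2 seen; split=> //; split.
    move=> i j iN jN ij.
    have [|_ _ Ri] := fl (B + i); first by rewrite /region; lia.
    have [|_ _ Rj] := fl (B + j); first by rewrite /region; lia.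
    rewrite ij in Ri; move: (R_trans _ _ _ Ri (R_sym _ _ Rj)).
    by rewrite /R !addKn.
  move=> i j iN jN cij.
  (* An edge between two of the first [N] vertices was processed when its lower end was the current
     vertex. *)
  suff H z : conn (edge A) m0 (m0 + N) (m0 + i) z -> s2.2 (B + i) = s2.2 (B + (z - m0)).
    by rewrite (H _ cij) addKn.
  move: z; apply: conn_ind_r; first by rewrite addKn.
  move=> y z _ -> [hy hz /orP[] /andP[yz ed]].
    have := seen (y - m0) (z - y); rewrite subnKC; last by lia.
    by move=> /(_ _ ed) <-; [congr (s2.2 _)|]; lia.
  have := seen (z - m0) (y - z); rewrite subnKC; last by lia.
  by move=> /(_ _ ed) <-; [congr (s2.2 _)|]; lia.
- by lia.
Qed.

(** * Moving a vertex down *)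

Definition skip : cmd := Block [::].

(** The sum of the two truncated differences is zero exactly when the labels agree. A later match
    overwrites an earlier one; any match serves. *)
Definition find_period : cmd :=
  Seq (Block [:: IConst rFound 0; IConst rD 0; IMove rC rP; IAdd rY rBH rX;
                 ISub rY rY rP; ILoad rL rY])
    (While rC
      (Seq (Block [:: IAdd rY rY rP; IAdd rD rD rP; ILoad rW rY; ISub rF rW rL;
                      ISub rW rL rW; IAdd rF rF rW])
      (Seq (If rF skip (Block [:: IMove rFound rD]))
           (Block [:: ISub rC rC rOne])))).

Definition shift_down : cmd :=
  Seq (Block [:: IAdd rT rX rFound; IAdd rF rU rOne; ISub rF rF rT])
    (While rF (Block [:: ISub rU rU rFound; IAdd rF rU rOne; ISub rF rF rT])).

(** [rT] is the first vertex of the window at [p], translated by [rS]. The two guards test whether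
    [v] lies in the translated window before its label is read. *)
Definition answer_locally : cmd :=
  Seq (Block [:: IConst rDone 1; IConst rAns 0; IAdd rT rS rP; IAdd rF rV rOne; ISub rF rF rT])
    (If rF
      (Seq (Block [:: ISub rY rV rT; ISub rF rN rY])
        (If rF
          (Seq (Block [:: IAdd rY rY rBH; ILoad rW rY; ISub rF rW rL; ISub rW rL rW;
                          IAdd rF rF rW])
            (If rF skip (Block [:: IConst rAns 1])))
          skip))
      skip).

(* Sets rX to the translate of u by a multiple rS of p that lies in
   [p^2 + p, p^2 + 2p), or to u itself, with rS = 0, if u < p^2 + 2p. *)
Definition residue : cmd :=
  Seq (Block [:: IMove rX rU; IAdd rF rX rOne; ISub rF rF rThr])
  (Seq (While rF (Block [:: ISub rX rX rP; IAdd rF rX rOne; ISub rF rF rThr]))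
       (Block [:: ISub rS rU rX])).

(* Either translates u down into its component, or finds that the component of u
   is bounded and answers the query from the window around its translate. *)
Definition reduce : cmd :=
  Seq residue
    (If rS (Seq find_period (If rFound shift_down answer_locally)) skip).

(** * Correctness of the reduction of a vertex *)

Section Reduce.

Variables (A : dfa) (p : nat).
Hypothesis Astd : standard_one_loop A p.
Variables (BH : nat) (D : nat -> nat).
(** The walks to be captured stay below [3 * (p * p) + 3 * p], which is at most [6 * (p * p)]; the
    factor eight is obtained by three doublings. *)
Let N := 8 * (p * p).
Hypothesis D_labels : labels_window A p p BH N D.

Let p_gt0 : 0 < p. Proof. by case: Astd. Qed.

Definition linked (u v : nat) : Prop := exists hi, conn (edge A) 0 hi u v.

Lemma linked_trans u v w : linked u v -> linked v w -> linked u w.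
Proof.
move=> [h1 c1] [h2 c2]; exists (maxn h1 h2); apply: (@conn_trans _ _ _ _ v).
  by apply: conn_widen c1; rewrite ?leq_maxl.
by apply: conn_widen c2; rewrite ?leq_maxr.
Qed.

Lemma linked_sym u v : linked u v -> linked v u.
Proof. by case=> h c; exists h; apply: conn_sym. Qed.

Lemma linked_refl u : linked u u.
Proof. by exists 0; apply: conn_refl. Qed.

Lemma labels_conn x y :
  p <= x -> p <= y -> x < N + p -> y < N + p ->
  conn (edge A) p (N + p) x y -> D (BH + (x - p)) = D (BH + (y - p)).
Proof.
move=> px py xN yN; case: D_labels => _ H c; apply: H; try lia.
by rewrite addnC [p + _]addnC subnK // [p + _]addnC subnK.
Qed.

Lemma conn_labels x y :
  p <= x -> p <= y -> x < N + p -> y < N + p ->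
  D (BH + (x - p)) = D (BH + (y - p)) -> conn (edge A) p (p + (N + p)) x y.
Proof.
move=> px py xN yN; case: D_labels => H _ /H.
by rewrite [p + (x - p)]addnC [p + (y - p)]addnC !subnK //; apply; lia.
Qed.

(** Equal labels give a walk that stays at or above [p], which therefore can be translated up by any
    multiple of [p]. *)
Lemma linked_shift x k s :
  p * p + p <= x < p * p + 2 * p -> k <= p ->
  D (BH + (x - p)) = D (BH + (x - p) + k * p) ->
  linked (x + k * p + s * p) (x + s * p).
Proof.
move=> hx kp; have kpp : k * p <= p * p by rewrite leq_mul2r kp orbT.
have -> : BH + (x - p) + k * p = BH + (x + k * p - p) by lia.
move=> /conn_labels H; apply: linked_sym.
exists (p + (N + p) + s * p).
have := conn_shift (edge_periodic Astd) s (leqnn p) (H _ _ _ _).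
by move=> h; apply: conn_widen (h _ _ _ _) => //; rewrite /N; nia.
Qed.

(** Since connected vertices of the window share a label, the hypothesis on labels yields that of
    [component_bounded]. The component is then confined to a translate of the window, whose labels
    settle the question for every [v]. *)
Lemma linked_local x s v :
  p * p + p <= x < p * p + 2 * p ->
  (forall k, 0 < k <= p -> D (BH + (x - p)) <> D (BH + (x - p) + k * p)) ->
  linked (x + s * p) v <->
  [/\ s * p + p <= v, v - (s * p + p) < N &
      D (BH + (v - (s * p + p))) = D (BH + (x - p))].
Proof.
move=> hx nok.
have pp : p <= p * p by rewrite leq_pmull.
split.
- case=> hi c.
  have [|h1 h2] := component_bounded (edge_periodic Astd) p_gt0 (@edge_short _ _ Astd) hx _ c.
    move=> k hk ck; apply: (nok k hk).
    have kpp : k * p <= p * p by rewrite leq_mul2r; case/andP: hk => _ ->; rewrite orbT.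
    have -> : BH + (x - p) + k * p = BH + (x + k * p - p) by lia.
    apply: labels_conn; rewrite /N; try lia.
    by apply: conn_widen ck; lia.
  have hv : p <= v - s * p < 2 * (p * p) + 3 * p by apply: conn_range h2 _; lia.
  split; rewrite /N; try lia.
  have -> : v - (s * p + p) = v - s * p - p by lia.
  apply/esym/labels_conn; rewrite /N; try lia.
  by apply: conn_widen h2; lia.
- case=> h1 h2.
  have -> : v - (s * p + p) = v - s * p - p by lia.
  move=> /esym/conn_labels c; exists (p + (N + p) + s * p).
  have {}c := conn_shift (edge_periodic Astd) s (leqnn p) (c _ _ _ _).
  rewrite -[X in conn _ _ _ _ X](@subnK (s * p) v); last by lia.
  by apply: conn_widen (c _ _ _ _); rewrite ?/N; lia.
Qed.

Definition ready (s : store) : Prop :=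
  [/\ s.1 rOne = 1, s.1 rP = p, s.1 rThr = p * p + 2 * p & s.1 rN = N /\ s.1 rBH = BH].

Lemma ready_unchanged c s s' :
  ready s -> unchanged c s s' ->
  all (fun r => r \notin writes c) [:: rOne; rP; rThr; rN; rBH] -> ready s'.
Proof.
move=> [q1 q2 q3 [q4 q5]] un /and5P[w1 w2 w3 w4 /andP[w5 _]].
by split; [| | |split]; rewrite un.
Qed.

Lemma wp_residue s u :
  ready s -> s.1 rU = u ->
  wp residue (5 * u + 5) (fun s' => exists j,
    [/\ s'.2 = s.2, s'.1 rX + j * p = u, s'.1 rS = j * p, s'.1 rX < p * p + 2 * p &
        0 < j -> p * p + p <= s'.1 rX]) s.
Proof.
move=> [h1 hP hThr [hN hBH]] hU.
apply: (@wp_seq _ _ _ 3 (5 * u + 2)); last by lia.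
apply: wp_block => //.
apply: (@wp_seq _ _ _ (5 * u + 1) 1); last by lia.
(* The current value is the variant; it drops by [p], which is at least 1. The loop subtracts only
   from values of at least [p * p + 2 * p], so a reduced value is still at least [p * p + p]. *)
apply: (@wp_while _ _ u 3 _ (fun k s' => exists j,
  [/\ s'.1 rX = k, k + j * p = u, s'.1 rF = k + 1 - (p * p + 2 * p), s'.2 = s.2 &
      0 < j -> p * p + p <= k])) => //.
- by exists 0; rewrite /= /upd /= hU h1 hThr; split=> //; lia.
- move=> k s' un [j [hX kj hF hm hk]] nz.
  have o1 : s'.1 rOne = 1 by rewrite un.
  have oP : s'.1 rP = p by rewrite un.
  have oT : s'.1 rThr = p * p + 2 * p by rewrite un.
  apply: wp_block => //; rewrite /= /upd /= o1 oP oT hX.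
  have kge : p * p + 2 * p <= k by rewrite hF in nz; lia.
  by exists (k - p); [lia|exists j.+1; rewrite mulSn; split=> //; lia].
- move=> k s' un [j [hX kj hF hm hk]] z.
  have oU : s'.1 rU = u by rewrite un.
  apply: wp_block => //; exists j; rewrite /= /upd /= oU hX.
  by rewrite hF in z; split=> //; lia.
- by lia.
Qed.

Lemma wp_find_period s x :
  ready s -> s.1 rX = x -> s.2 = D -> p <= x ->
  wp find_period (13 * p + 7) (fun s' =>
    [/\ s'.2 = D, s'.1 rL = D (BH + (x - p)) &
        (exists k, [/\ 0 < k <= p, s'.1 rFound = k * p &
            D (BH + (x - p)) = D (BH + (x - p) + k * p)]) \/
        s'.1 rFound = 0 /\ forall k, 0 < k <= p ->
          D (BH + (x - p)) <> D (BH + (x - p) + k * p)]) s.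
Proof.
move=> [h1 hP hThr [hN hBH]] hX hm px.
apply: (@wp_seq _ _ _ 6 (13 * p + 1)); last by lia.
apply: wp_block => //.
apply: (@wp_while _ _ p 11 _ (fun k s' => exists j,
  [/\ k + j = p, s'.1 rC = k, s'.1 rY = BH + (x - p) + j * p, s'.1 rD = j * p &
   [/\ s'.2 = D, s'.1 rL = D (BH + (x - p)) &
        (exists k, [/\ 0 < k <= p, s'.1 rFound = k * p &
            D (BH + (x - p)) = D (BH + (x - p) + k * p)]) \/
        s'.1 rFound = 0 /\ forall k, 0 < k <= j ->
          D (BH + (x - p)) <> D (BH + (x - p) + k * p)]])) => //.
- exists 0; rewrite /= /upd /= hX hm hP hBH !addn0; split=> //; first by lia.
  by split=> //; [congr D; lia|right; split=> // k; lia].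
- move=> k s' un [j [kj hC hY hD [hm' hL hF]]] nz.
  have o1 : s'.1 rOne = 1 by rewrite un.
  have oP : s'.1 rP = p by rewrite un.
  have Yn : BH + (x - p) + j * p + p = BH + (x - p) + j.+1 * p by rewrite mulSn; lia.
  have Dn : j * p + p = j.+1 * p by rewrite mulSn addnC.
  apply: (@wp_seq _ _ _ 6 5) => //.
  apply: (wp_block_post (P := fun s1 => [/\ s1.1 rY = BH + (x - p) + j.+1 * p,
      s1.1 rD = j.+1 * p, s1.2 = D & s1.1 rF =
      D (BH + (x - p) + j.+1 * p) - D (BH + (x - p)) +
      (D (BH + (x - p)) - D (BH + (x - p) + j.+1 * p))])) => //.
    by rewrite /= /upd /= oP hL hm' hY hD Yn Dn.
  move=> s1 un1 [Y1 D1 M1 F1].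
  have O1 : s1.1 rOne = 1 by rewrite un1.
  have C1 : s1.1 rC = k by rewrite un1.
  have L1 : s1.1 rL = D (BH + (x - p)) by rewrite un1.
  have Fd1 : s1.1 rFound = s'.1 rFound by rewrite un1.
  apply: (@wp_seq _ _ _ 4 1) => //.
  apply: (@wp_if _ _ _ 2); rewrite F1 => h; apply: wp_block => //; apply: wp_block => //;
    rewrite /= /upd /= O1 C1 ?D1 ?Fd1; exists (k - 1); try lia;
    exists j.+1; split=> //; try lia; split=> //.
  + case: hF => [[k' hk']|[hF hn]]; [by left; exists k'|right; split=> // k' hk'].
    case: (ltnP j k') => jk; last by apply: hn; lia.
    have kE : k' = j.+1 by lia.
    by rewrite kE; lia.
  + by left; exists j.+1; split; lia.
- by move=> k s' un [j [kj hC hY hD [hm' hL hF]]] z; have jp : j = p; [lia|rewrite jp in hF].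
- by lia.
Qed.

(** Every value of [rU] is some [x + i * p], and while [k <= i] the subtraction is justified by
    [linked_shift]. The loop ends below [x + k * p], where [k <= p]. *)
Lemma wp_shift_down s x j u k :
  ready s -> s.1 rX = x -> s.1 rU = u -> u = x + j * p ->
  p * p + p <= x < p * p + 2 * p ->
  0 < k <= p -> s.1 rFound = k * p ->
  D (BH + (x - p)) = D (BH + (x - p) + k * p) ->
  wp shift_down (5 * u + 4) (fun s' =>
    [/\ s'.2 = s.2, s'.1 rU < 2 * (p * p) + 2 * p & linked u (s'.1 rU)]) s.
Proof.
move=> [h1 hP hThr [hN hBH]] hX hU uE hx hk hF hD.
apply: (@wp_seq _ _ _ 3 (5 * u + 1)); last by lia.
apply: wp_block => //.
have kpp : k * p <= p * p by rewrite leq_mul2r; case/andP: hk => _ ->; rewrite orbT.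
have kp0 : 0 < k * p by rewrite muln_gt0 p_gt0 andbT; case/andP: hk.
apply: (@wp_while _ _ u 3 _ (fun w s' => exists i,
  [/\ s'.1 rU = w, w = x + i * p, s'.1 rF = w + 1 - (x + k * p), s'.2 = s.2 &
      linked u w])) => //.
- exists j; rewrite /= /upd /= hX hU hF h1; split=> //; exact: linked_refl.
- move=> w s' un [i [hU' wE hF' hm lw]] nz.
  have o1 : s'.1 rOne = 1 by rewrite un.
  have oF : s'.1 rFound = k * p by rewrite un.
  have oT : s'.1 rT = x + k * p by rewrite un //= /upd /= hX hF.
  apply: wp_block => //; rewrite /= /upd /= o1 oF oT hU'.
  have wge : x + k * p <= w by rewrite hF' in nz; lia.
  have ki : k <= i by move: wge; rewrite wE leq_add2l leq_mul2r; case: (p) p_gt0.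
  exists (w - k * p); first by lia.
  have wE' : w - k * p = x + (i - k) * p by rewrite mulnBl; lia.
  exists (i - k); split=> //.
  apply: linked_trans lw _; rewrite wE'.
  have -> : w = x + k * p + (i - k) * p by rewrite wE -addnA -mulnDl subnKC.
  by apply: linked_shift => //; case/andP: hk.
- move=> w s' un [i [hU' wE hF' hm lw]] z; rewrite hU'; split=> //.
  by rewrite hF' in z; lia.
- by lia.
Qed.

Lemma wp_answer_locally s x j u v :
  ready s -> s.1 rL = D (BH + (x - p)) -> s.1 rS = j * p -> s.2 = D ->
  s.1 rV = v -> u = x + j * p ->
  p * p + p <= x < p * p + 2 * p ->
  (forall k, 0 < k <= p -> D (BH + (x - p)) <> D (BH + (x - p) + k * p)) ->
  wp answer_locally 20 (fun s' => [/\ s'.2 = D, s'.1 rDone = 1 &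
    exists2 b : bool, s'.1 rAns = b & b <-> linked u v]) s.
Proof.
move=> [h1 hP hThr [hN hBH]] hL hS hm hV -> hx nok.
have crit := linked_local j v hx nok.
apply: (@wp_seq _ _ _ 5 15) => //.
apply: (wp_block_post (P := fun s1 => [/\ s1.1 rDone = 1, s1.1 rAns = 0,
    s1.1 rT = j * p + p, s1.1 rF = v + 1 - (j * p + p) & s1.2 = D])) => //.
  by rewrite /= /upd /= h1 hV hS hP.
move=> s1 un1 [D1 A1 T1 F1 M1].
have V1 : s1.1 rV = v by rewrite un1.
have N1 : s1.1 rN = N by rewrite un1.
apply: (@wp_if _ _ _ 13); rewrite F1 => hF; last first.
  by apply: wp_block => //; split=> //; exists false => //; split=> // /crit[]; lia.
apply: (@wp_seq _ _ _ 2 11) => //.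
apply: (wp_block_post (P := fun s2 => [/\ s2.1 rY = v - (j * p + p),
    s2.1 rF = N - (v - (j * p + p)) & s2.2 = D])) => //.
  by rewrite /= /upd /= V1 N1 T1.
move=> s2 un2 [Y2 F2 M2].
have D2 : s2.1 rDone = 1 by rewrite un2.
have A2 : s2.1 rAns = 0 by rewrite un2.
have L2 : s2.1 rL = D (BH + (x - p)) by rewrite un2 // un1.
have B2 : s2.1 rBH = BH by rewrite un2 // un1.
apply: (@wp_if _ _ _ 9); rewrite F2 => hF'; last first.
  by apply: wp_block => //; split=> //; exists false => //; split=> // /crit[]; lia.
apply: (@wp_seq _ _ _ 5 4) => //.
apply: (wp_block_post (P := fun s3 => s3.2 = D /\ s3.1 rF =
    D (BH + (v - (j * p + p))) - D (BH + (x - p)) +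
    (D (BH + (x - p)) - D (BH + (v - (j * p + p)))))) => //.
  by rewrite /= /upd /= B2 L2 Y2 M2 [_ + BH]addnC.
move=> s3 un3 [M3 F3].
have D3 : s3.1 rDone = 1 by rewrite un3.
have A3 : s3.1 rAns = 0 by rewrite un3.
apply: (@wp_if _ _ _ 2); rewrite F3 => hE; apply: wp_block => //; split=> //.
  by exists false => //; split=> // /crit[]; lia.
by exists true => //; split=> // _; apply/crit; split; lia.
Qed.

Lemma wp_reduce s u v :
  ready s -> s.2 = D -> s.1 rU = u -> s.1 rV = v -> s.1 rDone = 0 ->
  wp reduce (10 * u + 13 * p + 50) (fun s' => s'.2 = D /\
    (s'.1 rDone = 1 /\ (exists2 b : bool, s'.1 rAns = b & b <-> linked u v) \/
     [/\ s'.1 rDone = 0, s'.1 rV = v, s'.1 rU < 2 * (p * p) + 2 * p & linked u (s'.1 rU)])) s.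
Proof.
move=> rd hm hU hV h0.
apply: (@wp_seq _ _ _ (5 * u + 5) (5 * u + 13 * p + 45)); last by lia.
move: (wp_residue rd hU) => /wp_weaken; apply=> // s1 un1 [j [hm1 uE hS hX hj]].
have rd1 := ready_unchanged rd un1 isT.
have -> : 5 * u + 13 * p + 45 = 5 * u + 13 * p + 43 + 2 by lia.
apply: wp_if => hS0; last first.
  apply: wp_block => //=; split; first by rewrite hm1.
  have uX : s1.1 rX = u by lia.
  right; rewrite !un1 // h0 hV hU; split=> //; first by lia.
  exact: linked_refl.
have j0 : 0 < j by case: (j) hS hS0 => //; rewrite mul0n.
have hx : p * p + p <= s1.1 rX < p * p + 2 * p by rewrite hX hj.
have px : p <= s1.1 rX by lia.
apply: (@wp_seq _ _ _ (13 * p + 7) (5 * u + 36)); last by lia.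
move: (wp_find_period rd1 (erefl _) (etrans hm1 hm) px)
  => /wp_weaken; apply=> // s2 un2 [hm2 hL hF].
have rd2 := ready_unchanged rd1 un2 isT.
have -> : 5 * u + 36 = 5 * u + 34 + 2 by lia.
have X2 : s2.1 rX = s1.1 rX by rewrite un2.
have U2 : s2.1 rU = u by rewrite un2 // un1.
have V2 : s2.1 rV = v by rewrite un2 // un1.
have S2 : s2.1 rS = j * p by rewrite un2.
case: hF => [[k [hk Fk Dk]]|[F0 nok]].
  apply: wp_if => h; last by move: h; rewrite Fk; case/andP: hk; nia.
  move: (wp_shift_down rd2 X2 U2 (esym uE) hx hk Fk Dk)
    => /wp_weaken; apply=> [|s3 un3 [hm3 U3 l3]].
    by lia.
  split; first by rewrite hm3.
  by right; split=> //; rewrite un3 // ?un2 // un1.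
apply: wp_if => // _.
move: (wp_answer_locally rd2 hL S2 hm2 V2 (esym uE) hx nok)
  => /wp_weaken; apply=> [|s3 un3 [hm3 D3 A3]].
  by lia.
by split=> //; left.
Qed.

End Reduce.

(** * The decision procedure *)

(* Register 1 is never written and therefore holds 0. *)
Definition load_header : cmd :=
  Block [:: IConst rOne 1; IConst rThree 3; ILoad rX 1; ILoad rQ rOne; IAdd rQ rQ rOne;
            IMove rQ0 rQ; IAdd rA rX rX; IAdd rA rA rA; IAdd rA rA rX;
            IAdd rA rA rOne; IAdd rA rA rOne].

Definition measure : cmd :=
  Seq (Block [:: IConst rL 0; ILoad rX rA])
  (Seq (While rX (Block [:: IAdd rL rL rOne; IAdd rA rA rOne; ILoad rX rA]))
       (Block [:: IAdd rA rA rOne])).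

(** The input does not contain [p]. It is measured as the length of the [(Diamond, One)]-tail at the
    initial state, while [rQ] follows the [(One, One)]-transitions in step and ends in the state
    after [p] of them. *)
Definition loop_constant : cmd :=
  Seq (Block [:: IConst rP 0; IMove rQ rQ0; IAdd rW rQ rQ; IAdd rW rW rW;
                 IAdd rW rW rQ; ISub rW rW rOne; ILoad rT rW])
    (While rT
      (Seq (Block [:: IAdd rW rT rT; IAdd rW rW rW; IAdd rW rW rT; ISub rW rW rOne;
                      ILoad rT rW])
           (Block [:: IAdd rW rQ rQ; IAdd rW rW rW; IAdd rW rW rQ; ISub rW rW rThree;
                      ILoad rQ rW; IAdd rP rP rOne]))).

Definition square : cmd :=
  Seq (Block [:: IConst rSq 0; IMove rC rP])
    (While rC (Block [:: IAdd rSq rSq rP; ISub rC rC rOne])).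

(** The window at [p] comes first because [rQ] already holds its starting state; the window at [0]
    is stored right behind it. *)
Definition label_windows : cmd :=
  Seq (Block [:: IAdd rN rSq rSq; IAdd rN rN rN; IAdd rN rN rN; IAdd rK rN rP;
                 IMove rB rA; IMove rBH rA; IAdd rThr rSq rP; IAdd rThr rThr rP])
  (Seq label
  (Seq (Block [:: IAdd rB rB rK; IMove rBG rB; IMove rQ rQ0])
       label)).

Definition preprocess : cmd :=
  Seq load_header
  (Seq measure (Seq (Block [:: IMove rU rL])
  (Seq measure (Seq (Block [:: IMove rV rL])
  (Seq loop_constant (Seq square label_windows)))))).

Definition compare_labels : cmd :=
  Seq (Block [:: IConst rAns 0; IAdd rY rBG rU; ILoad rL rY; IAdd rY rBG rV;
                 ILoad rW rY; ISub rF rW rL; ISub rW rL rW; IAdd rF rF rW])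
    (If rF skip (Block [:: IConst rAns 1])).

(** Exchanging [rU] and [rV] lets the same code reduce both vertices. *)
Definition decide : cmd :=
  Seq (Block [:: IConst rDone 0])
  (Seq reduce
    (If rDone skip
      (Seq (Block [:: IMove rT rU; IMove rU rV; IMove rV rT])
      (Seq reduce (If rDone skip compare_labels))))).

Definition reachability : cmd := Seq preprocess decide.

(** * Correctness and running time of the stages *)

Lemma wp_measure s a k :
  s.1 rA = a -> s.1 rOne = 1 ->
  (forall i, i < k -> s.2 (a + i) = 1) -> s.2 (a + k) = 0 ->
  wp measure (5 * k + 4) (fun s' =>
    [/\ s'.2 = s.2, s'.1 rL = k & s'.1 rA = a + k + 1]) s.
Proof.
move=> hA h1 ones zero.
apply: (@wp_seq _ _ _ 2 (5 * k + 2)); last by lia.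
apply: wp_block => //.
apply: (@wp_seq _ _ _ (5 * k + 1) 1); last by lia.
apply: (@wp_while _ _ k 3 _ (fun m s' => exists i, [/\ m + i = k, s'.1 rL = i,
  s'.1 rA = a + i, s'.2 = s.2 & s'.1 rX = s.2 (a + i)])).
- by exists 0; rewrite /= /upd /= hA !addn0.
- move=> m s' un [i [mi hL hA' hm hX]] nz.
  have o1 : s'.1 rOne = 1 by rewrite un.
  have m_gt0 : 0 < m.
    by rewrite lt0n; apply/eqP => m0; apply: nz; rewrite hX -zero; congr s.2; lia.
  apply: wp_block => //; rewrite /= /upd /= o1 hA' hL hm.
  exists m.-1; first by lia.
  by exists i.+1; rewrite !addnS !addn0; split=> //; lia.
- move=> m s' un [i [mi hL hA' hm hX]] z.
  have o1 : s'.1 rOne = 1 by rewrite un.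
  apply: wp_block => //; rewrite /= /upd /= o1 hA' hL.
  have {z} -> : i = k.
    by case: (ltngtP i k) => // ik; [rewrite hX ones in z|lia].
  by [].
- by lia.
Qed.

Lemma wp_loop_constant A p s :
  standard_one_loop A p -> encodes A s.2 ->
  s.1 rOne = 1 -> s.1 rThree = 3 -> s.1 rQ0 = encode_target (walk A 0 0) ->
  wp loop_constant (13 * p + 8) (fun s' =>
    [/\ s'.2 = s.2, s'.1 rP = p & s'.1 rQ = encode_target (walk A p 0)]) s.
Proof.
move=> Astd enc h1 h3 hQ0.
have nz11 m : encode_target (walk A m 0) != 0 by case: (walk11 Astd m) => q ->.
apply: (@wp_seq _ _ _ 7 (13 * p + 1)); last by lia.
apply: (wp_block_post (P := fun s1 => [/\ s1.1 rP = 0, s1.1 rQ = encode_target (walk A 0 0),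
    s1.1 rT = encode_target (walk A 0 1) & s1.2 = s.2])) => //.
  have nz0 : s.1 rQ0 != 0 by rewrite hQ0.
  by rewrite /= /upd /= h1 (lookupD1 enc hQ0 nz0).
move=> s1 un1 [P1 Q1 T1 M1].
apply: (@wp_while _ _ p 11 _ (fun k s' => exists j, [/\ k + j = p, s'.1 rP = j,
  s'.1 rQ = encode_target (walk A j 0), s'.1 rT = encode_target (walk A 0 j.+1) &
  s'.2 = s.2])).
- by exists 0; rewrite addn0; split.
- move=> k s' un [j [kj hP hQ hT hm]] /eqP nz.
  have o1 : s'.1 rOne = 1 by rewrite un // un1.
  have o3 : s'.1 rThree = 3 by rewrite un // un1.
  have enc' : encodes A s'.2 by rewrite hm.
  have jp : j < p by apply: (walk_short Astd (m := 0)) => h; rewrite hT h in nz.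
  apply: (@wp_seq _ _ _ 5 6) => //.
  apply: (wp_block_post (P := fun s2 => s2.1 rT = encode_target (walk A 0 j.+2) /\
    s2.2 = s.2)) => //.
    by rewrite /= /upd /= o1 (lookupD1 enc' hT nz).
  move=> s2 un2 [T2 M2].
  have O2 : s2.1 rOne = 1 by rewrite un2.
  have O3 : s2.1 rThree = 3 by rewrite un2.
  have P2 : s2.1 rP = j by rewrite un2.
  have Q2 : s2.1 rQ = encode_target (walk A j 0) by rewrite un2.
  have nzQ : s2.1 rQ != 0 by rewrite Q2.
  have enc2 : encodes A s2.2 by rewrite M2.
  apply: wp_block => //; rewrite /= /upd /= O2 O3 (lookup11 enc2 Q2 nzQ) P2 T2 M2.
  by exists k.-1; [lia|exists j.+1; rewrite addn1; split=> //; lia].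
- move=> k s' un [j [kj hP hQ hT hm]] z.
  have jp : j = p.
    have : ~~ (j < p).
      apply/negP => /(walk_defined Astd (m := 0)); move: z; rewrite hT.
      by case: (walk A 0 j.+1).
    by lia.
  by rewrite jp in hP hQ.
- by lia.
Qed.

Lemma wp_square s p :
  s.1 rP = p -> s.1 rOne = 1 ->
  wp square (4 * p + 3) (fun s' => s'.2 = s.2 /\ s'.1 rSq = p * p) s.
Proof.
move=> hP h1.
apply: (@wp_seq _ _ _ 2 (4 * p + 1)); last by lia.
apply: wp_block => //.
apply: (@wp_while _ _ p 2 _ (fun k s' => exists j, [/\ k + j = p, s'.1 rC = k,
  s'.1 rSq = j * p & s'.2 = s.2])).
- by exists 0; rewrite addn0 /= /upd /= hP.
- move=> k s' un [j [kj hC hS hm]] nz.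
  have o1 : s'.1 rOne = 1 by rewrite un.
  have oP : s'.1 rP = p by rewrite un.
  apply: wp_block => //; rewrite /= /upd /= o1 oP hC hS.
  by exists (k - 1); [lia|exists j.+1; rewrite mulSn; split=> //; lia].
- move=> k s' un [j [kj hC hS hm]] z; split=> //; rewrite hS.
  by congr (_ * _); lia.
- by lia.
Qed.

Lemma labels_window_ext A p m0 B N D D' :
  (forall i, i < N + p -> D' (B + i) = D (B + i)) ->
  labels_window A p m0 B N D -> labels_window A p m0 B N D'.
Proof.
move=> E [sound complete]; split=> i j hi hj; rewrite !E; try lia; first exact: sound.
exact: complete.
Qed.

Definition window (p : nat) : nat := 8 * (p * p).

Definition label_time (p : nat) : nat :=
  5 * (window p + p) + window p * (14 * p + 7 * (window p + p) + 30) + 6.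

Lemma wp_label_windows A p s :
  standard_one_loop A p -> encodes A s.2 -> 5 * nstates A + 2 <= s.1 rA ->
  s.1 rOne = 1 -> s.1 rThree = 3 -> s.1 rP = p -> s.1 rSq = p * p ->
  s.1 rQ0 = encode_target (walk A 0 0) -> s.1 rQ = encode_target (walk A p 0) ->
  wp label_windows (2 * label_time p + 11) (fun s' => exists BH,
    [/\ ready p BH s', labels_window A p p BH (window p) s'.2 &
        labels_window A p 0 (s'.1 rBG) (window p) s'.2]) s.
Proof.
move=> Astd enc hA h1 h3 hP hSq hQ0 hQ; set BH := s.1 rA; set N := window p.
have enc_low (s' : store) : (forall a, a < BH -> s'.2 a = s.2 a) -> encodes A s'.2.
  by move=> low q j j5; rewrite low; [exact: enc|rewrite /BH; have := ltn_ord q; lia].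
apply: (@wp_seq _ _ _ 8 (2 * label_time p + 3)); last by lia.
apply: (wp_block_post (P := fun s1 => [/\ s1.1 rN = N, s1.1 rK = N + p, s1.1 rB = BH,
    s1.1 rBH = BH & s1.1 rThr = p * p + 2 * p /\ s1.2 = s.2])) => //.
  rewrite /= /upd /= hP hSq; have -> : p * p + p * p + (p * p + p * p) +
    (p * p + p * p + (p * p + p * p)) = N by rewrite /N /window; lia.
  by split=> //; split=> //; lia.
move=> s1 un1 [N1 K1 B1 BH1 [Thr1 M1]].
have One1 : s1.1 rOne = 1 by rewrite un1.
have Three1 : s1.1 rThree = 3 by rewrite un1.
have P1 : s1.1 rP = p by rewrite un1.
have Q1 : s1.1 rQ = encode_target (walk A p 0) by rewrite un1.
have Q01 : s1.1 rQ0 = encode_target (walk A 0 0) by rewrite un1.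
have enc1 : encodes A s1.2 by rewrite M1.
apply: (@wp_seq _ _ _ (label_time p) (label_time p + 3)); last by lia.
move: (wp_label Astd hA enc1 One1 Three1 B1 N1 K1 Q1) => /wp_weaken.
apply=> // s2 un2 [low2 lab2].
apply: (@wp_seq _ _ _ 3 (label_time p)); last by lia.
have K2 : s2.1 rK = N + p by rewrite un2.
have B2 : s2.1 rB = BH by rewrite un2.
have Q02 : s2.1 rQ0 = encode_target (walk A 0 0) by rewrite un2.
apply: (wp_block_post (P := fun s3 => [/\ s3.1 rB = BH + (N + p), s3.1 rBG = BH + (N + p),
    s3.1 rQ = encode_target (walk A 0 0) & s3.2 = s2.2])) => //.
  by rewrite /= /upd /= K2 B2 Q02.
move=> s3 un3 [B3 BG3 Q3 M3].
have One3 : s3.1 rOne = 1 by rewrite un3 // un2.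
have Three3 : s3.1 rThree = 3 by rewrite un3 // un2.
have K3 : s3.1 rK = N + p by rewrite un3.
have N3 : s3.1 rN = N by rewrite un3 // un2.
have P3 : s3.1 rP = p by rewrite un3 // un2.
have Thr3 : s3.1 rThr = p * p + 2 * p by rewrite un3 // un2.
have BH3 : s3.1 rBH = BH by rewrite un3 // un2.
have enc3 : encodes A s3.2 by apply: enc_low => a aB; rewrite M3 low2 // M1.
have hB' : 5 * nstates A + 2 <= BH + (N + p) by rewrite /BH; lia.
move: (wp_label Astd hB' enc3 One3 Three3 B3 N3 K3 Q3) => /wp_weaken.
apply=> // s4 un4 [low4 lab4]; exists BH; split.
- by split; [| | |split]; rewrite un4.
- apply: labels_window_ext lab2 => i hi; rewrite low4 ?M3 //; lia.
- by rewrite un4 // BG3.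
Qed.

Lemma wp_preprocess A p u v :
  standard_one_loop A p ->
  wp preprocess (2 * label_time p + 5 * size u + 5 * size v + 17 * p + 43) (fun s => exists BH,
    [/\ ready p BH s, s.1 rU = size u, s.1 rV = size v,
        labels_window A p p BH (window p) s.2 &
        labels_window A p 0 (s.1 rBG) (window p) s.2])
    (fun _ => 0, fun a => nth 0 (encode_input A u v) a).
Proof.
move=> Astd; set D := fun a => nth 0 (encode_input A u v) a.
have enc : encodes A D by exact: encodes_input.
set a0 := 5 * nstates A + 2.
have D_u i : D (a0 + i) = nth 0 (encode_unary u ++ encode_unary v) i.
  by rewrite /D /encode_input nth_cat size_encode_dfa ltnNge leq_addr addKn.
have D_v i : D (a0 + size u + 1 + i) = nth 0 (encode_unary v) i.
  have -> : a0 + size u + 1 + i = a0 + (size u + 1 + i) by lia.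
  rewrite D_u nth_cat /encode_unary size_cat size_nseq /=.
  by rewrite ltnNge leq_addr addKn.
have onesP (w : unary) i : i < size w -> nth 0 (encode_unary w) i = 1.
  by move=> h; rewrite /encode_unary nth_cat size_nseq h nth_nseq h.
have zeroP (w : unary) : nth 0 (encode_unary w) (size w) = 0.
  by rewrite /encode_unary nth_cat size_nseq ltnn subnn.
set T := label_time p.
apply: (@wp_seq _ _ _ 11 (2 * T + 5 * size u + 5 * size v + 17 * p + 32)); last by lia.
apply: (wp_block_post (P := fun s1 => [/\ s1.1 rOne = 1, s1.1 rThree = 3,
    s1.1 rQ0 = encode_target (walk A 0 0), s1.1 rA = a0 & s1.2 = D])) => //.
  rewrite /= /upd /= /D /encode_input /encode_dfa /= addn1; split=> //.
  by rewrite /a0; lia.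
move=> s1 _ [One1 Three1 Q1 A1 M1].
apply: (@wp_seq _ _ _ (5 * size u + 4) (2 * T + 5 * size v + 17 * p + 28)); last by lia.
have := @wp_measure s1 a0 (size u) A1 One1; rewrite M1.
move=> /(_ _ _)/wp_weaken; apply=> //.
- by move=> i h; rewrite D_u nth_cat size_cat size_nseq /= addn1 ltnS ltnW // onesP.
- by rewrite D_u nth_cat size_cat size_nseq /= addn1 ltnSn zeroP.
move=> s2 un2 [M2 L2 A2].
apply: (@wp_seq _ _ _ 1 (2 * T + 5 * size v + 17 * p + 27)); last by lia.
apply: (wp_block_post (P := fun s3 => s3.1 rU = size u /\ s3.2 = D)) => //.
move=> s3 un3 [U3 M3].
have One3 : s3.1 rOne = 1 by rewrite un3 // un2.
have A3 : s3.1 rA = a0 + size u + 1 by rewrite un3.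
apply: (@wp_seq _ _ _ (5 * size v + 4) (2 * T + 17 * p + 23)); last by lia.
have := @wp_measure s3 _ (size v) A3 One3; rewrite M3.
move=> /(_ _ _)/wp_weaken; apply=> //.
- by move=> i h; rewrite D_v onesP.
- by rewrite D_v zeroP.
move=> s4 un4 [M4 L4 A4].
apply: (@wp_seq _ _ _ 1 (2 * T + 17 * p + 22)); last by lia.
apply: (wp_block_post (P := fun s5 => s5.1 rV = size v /\ s5.2 = D)) => //.
move=> s5 un5 [V5 M5].
have One5 : s5.1 rOne = 1 by rewrite un5 // un4.
have Three5 : s5.1 rThree = 3 by rewrite un5 // un4 // un3 // un2.
have Q5 : s5.1 rQ0 = encode_target (walk A 0 0) by rewrite un5 // un4 // un3 // un2.
have U5 : s5.1 rU = size u by rewrite un5 // un4.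
have A5 : a0 <= s5.1 rA by rewrite un5 // A4; lia.
have enc5 : encodes A s5.2 by rewrite M5.
apply: (@wp_seq _ _ _ (13 * p + 8) (2 * T + 4 * p + 14)); last by lia.
move: (wp_loop_constant Astd enc5 One5 Three5 Q5) => /wp_weaken; apply=> // s6 un6 [M6 P6 Q6].
apply: (@wp_seq _ _ _ (4 * p + 3) (2 * T + 11)); last by lia.
have One6 : s6.1 rOne = 1 by rewrite un6.
move: (wp_square P6 One6) => /wp_weaken; apply=> // s7 un7 [M7 Sq7].
have enc7 : encodes A s7.2 by rewrite M7 M6.
have A7 : a0 <= s7.1 rA by rewrite un7 // un6.
have One7 : s7.1 rOne = 1 by rewrite un7.
have Three7 : s7.1 rThree = 3 by rewrite un7 // un6.
have P7 : s7.1 rP = p by rewrite un7.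
have Q07 : s7.1 rQ0 = encode_target (walk A 0 0) by rewrite un7 // un6.
have Q7 : s7.1 rQ = encode_target (walk A p 0) by rewrite un7.
move: (wp_label_windows Astd enc7 A7 One7 Three7 P7 Sq7 Q07 Q7) => /wp_weaken.
apply=> // s8 un8 [BH [rd l1 l2]]; exists BH; split=> //.
  by rewrite un8 // un7 // un6.
by rewrite un8 // un7 // un6.
Qed.

(** [conn_saturates] with [c = 2 * (p * p) + 2 * p] confines the walks between [u] and [v] to the
    vertices below [3 * (p * p) + 3 * p], which the window at [0] covers. *)
Lemma wp_compare_labels A p s u v :
  standard_one_loop A p -> labels_window A p 0 (s.1 rBG) (window p) s.2 ->
  s.1 rU = u -> s.1 rV = v ->
  u < 2 * (p * p) + 2 * p -> v < 2 * (p * p) + 2 * p ->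
  wp compare_labels 11 (fun s' =>
    exists2 b : bool, s'.1 rAns = b & b <-> linked A u v) s.
Proof.
move=> Astd lab hU hV hu hv; set D := s.2 in lab *; set B := s.1 rBG in lab *.
have p_gt0 : 0 < p by case: Astd.
have pp : p <= p * p by rewrite leq_pmull.
have crit : linked A u v <-> D (B + u) = D (B + v).
  case: lab => sound complete; split.
    case=> hi c; apply: complete; rewrite ?add0n /window; try lia.
    have := conn_saturates (edge_periodic Astd) p_gt0 (@edge_short _ _ Astd) _ _ _ c.
    move=> /(_ (2 * (p * p) + 2 * p)) h.
    apply: conn_widen (h _ _ _) => //; lia.
  move=> /sound c; exists (window p + p); rewrite !add0n in c.
  by apply: c; rewrite /window; lia.
apply: (@wp_seq _ _ _ 8 3) => //.
apply: (wp_block_post (P := fun s1 => s1.1 rAns = 0 /\ s1.1 rF =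
    D (B + v) - D (B + u) + (D (B + u) - D (B + v)))) => //.
  by rewrite /= /upd /= hU hV.
move=> s1 _ [A1 F1].
apply: (@wp_if _ _ _ 1); rewrite F1 => h; apply: wp_block => //.
  by exists false => //; split=> // /crit; lia.
by exists true => //; split=> // _; apply/crit; lia.
Qed.

Lemma wp_decide A p BH s u v :
  standard_one_loop A p -> ready p BH s -> s.1 rU = u -> s.1 rV = v ->
  labels_window A p p BH (window p) s.2 ->
  labels_window A p 0 (s.1 rBG) (window p) s.2 ->
  wp decide (10 * u + 10 * v + 26 * p + 119) (fun s' =>
    exists2 b : bool, s'.1 rAns = b & b <-> linked A u v) s.
Proof.
move=> Astd rd hU hV labH labG; set D := s.2 in labH labG.
apply: (@wp_seq _ _ _ 1 (10 * u + 10 * v + 26 * p + 118)); last by lia.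
apply: (wp_block_post (P := fun s1 => s1.1 rDone = 0 /\ s1.2 = D)) => // s1 un1 [Done1 M1].
have rd1 := ready_unchanged rd un1 isT.
have U1 : s1.1 rU = u by rewrite un1.
have V1 : s1.1 rV = v by rewrite un1.
apply: (@wp_seq _ _ _ (10 * u + 13 * p + 50) (10 * v + 13 * p + 66 + 2)); last by lia.
move: (wp_reduce Astd labH rd1 M1 U1 V1 Done1) => /wp_weaken; apply=> // s2 un2 [M2 post2].
apply: wp_if => h2.
  by apply: wp_block => //; case: post2 => [[_]|[]].
case: post2 => [[Done2]|[_ V2 U2 uu2]]; first by rewrite Done2 in h2.
set u' := s2.1 rU in U2 uu2.
have rd2 := ready_unchanged rd1 un2 isT.
apply: (@wp_seq _ _ _ 3 (10 * v + 13 * p + 63)); last by lia.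
apply: (wp_block_post (P := fun s3 => [/\ s3.1 rU = v, s3.1 rV = u' & s3.2 = D])) => //.
move=> s3 un3 [U3 V3 M3].
have rd3 := ready_unchanged rd2 un3 isT.
have Done3 : s3.1 rDone = 0 by rewrite un3.
apply: (@wp_seq _ _ _ (10 * v + 13 * p + 50) (11 + 2)); last by lia.
move: (wp_reduce Astd labH rd3 M3 U3 V3 Done3) => /wp_weaken; apply=> // s4 un4 [M4 post4].
(* [w] will be [v] itself if the second call of [reduce] answers, and the reduced [v] otherwise. *)
have swap w : linked A v w -> linked A w u' <-> linked A u v.
  move=> vw; split=> h; last first.
    by apply: linked_trans (linked_sym vw) _; apply: linked_trans (linked_sym h) uu2.
  by apply: linked_sym; apply: linked_trans vw _; apply: linked_trans h (linked_sym uu2).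
apply: wp_if => h4.
  apply: wp_block => //; case: post4 => [[_ [b Ab bE]]|[]//].
  by exists b => //; rewrite bE; apply: swap (linked_refl _ _).
case: post4 => [[Done4]|[_ V4 U4 vv4]]; first by rewrite Done4 in h4.
have BG4 : s4.1 rBG = s.1 rBG by rewrite un4 // un3 // un2 // un1.
rewrite -M4 -BG4 in labG.
move: (wp_compare_labels Astd labG (erefl _) V4 U4 U2) => /wp_weaken.
apply=> // s5 un5 [b Ab bE]; exists b => //; rewrite bE; exact: swap.
Qed.

Theorem theorem7p1 :
  exists (P : program) (c : nat),
    forall (A : dfa) (p : nat) (E : unary -> unary -> Prop),
      standard_one_loop A p ->
      recognizes A E ->
      undirected E ->
      finite_degree E ->
      forall u v : unary,
        exists b : bool,
          answers_within P (encode_input A u v)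
            (c * (size u + size v + p ^ 4)) b /\
          (b <-> same_component E u v).
Proof.
(* A generous constant: with all lower powers of [p] bounded by [p ^ 4], the total is at most
   [15 * (size u + size v) + 2100 * p ^ 4]. *)
exists (compile 0 reachability), (100 * 100) => A p E Astd AE E_sym _ u v.
have p_gt0 : 0 < p by case: Astd.
have H : wp reachability (100 * 100 * (size u + size v + p ^ 4)) (fun s =>
    exists2 b : bool, s.1 rAns = b & b <-> linked A (size u) (size v))
    (fun _ => 0, fun a => nth 0 (encode_input A u v) a).
  apply: (@wp_seq _ _ _ (2 * label_time p + 5 * size u + 5 * size v + 17 * p + 43)
    (10 * size u + 10 * size v + 26 * p + 119)).
    move: (wp_preprocess u v Astd) => /wp_weaken; apply=> // s1 _ [BH [rd U1 V1 l1 l2]].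
    exact: wp_decide Astd rd U1 V1 l1 l2.
  have p4 : p ^ 4 = p * p * (p * p) by rewrite !expnS expn0; lia.
  have h1 : p <= p ^ 4 by rewrite -{1}(expn1 p) leq_pexp2l.
  have h2 : p * p <= p ^ 4 by rewrite p4 leq_pmulr // muln_gt0 p_gt0.
  have h3 : p * p * p <= p ^ 4 by rewrite p4 leq_mul2l leq_pmulr // orbT.
  rewrite /label_time /window; move: h1 h2 h3 p4; move: (p ^ 4) => q; nia.
case: H => s' [t [R tT [b Ab bE]]].
exists b; split; first by apply: answers_within_compile; exists s', t.
by rewrite bE (same_componentE Astd AE E_sym).
Qed.
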